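(* Let $K$ be a field of characteristic zero and let $\lambda,\mu\in K^*$ be such that neither $\lambda$ nor $\mu$ is a root of unity. Let $\Lambda=K\langle x,y\mid xy=\lambda yx\rangle$ be the quantum plane and $A_1(\mu)=K\langle x,\partial\mid\partial x-\mu x\partial=1\rangle$ the quantum Weyl algebra. (1) The division rings of fractions $Q(\Lambda)$ and $Q(A_1(\mu))$ satisfy the commutative centralizer condition. (2) The quantum plane $\Lambda$, the quantum Weyl algebra $A_1(\mu)$, and any noncommutative subalgebra of the division ring $Q(\Lambda)$ with Gelfand-Kirillov dimension $<3$ admit the Dixmier partition and satisfy both the homogeneous centralizer condition and the commutative centralizer condition.
   Context: $K^*=K\setminus\{0\}$. Let $\overline K$ be the algebraic closure of $K$. For a $K$-algebra $A$ with centre $Z(A)$, put $\overline A=\overline K\otimes_K A$ and identify $A$ with $1\otimes A$. For $a\in A$ let $\operatorname{ad} a: b\mapsto [a,b]=ab-ba$, and put $C(a)=\ker(\operatorname{ad} a)$ (the centralizer of $a$ in $A$); $N(a)=\bigcup_{i\ge0}\ker\big((\operatorname{ad} a)^{i+1}\big)\subseteq A$; $D(a)=A\cap\bigoplus_{\nu\in\overline K}\{b\in\overline A:[a,b]=\nu b\}$; $F(a)=\{b\in A:\dim_K K[\operatorname{ad} a]\,b<\infty\}$. Types of elements $a\in A\setminus Z(A)$: $a\in\Delta_1(A)$ (strongly nilpotent) if $N(a)=A$ and $D(a)=C(a)$; $a\in\Delta_2(A)$ (weakly nilpotent) if $C(a)\ne N(a)\ne A$ and $D(a)=C(a)$; $a\in\Delta_3(A)$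 (strongly semi-simple) if $N(a)=C(a)$ and $D(a)=A$; $a\in\Delta_4(A)$ (weakly semi-simple) if $N(a)=C(a)$ and $C(a)\ne D(a)=F(a)\ne A$; $a\in\Delta_5(A)$ (generic) if $N(a)=D(a)=C(a)$. $A$ admits the Dixmier partition if $A\setminus Z(A)=\Delta_1(A)\cup\cdots\cup\Delta_5(A)$. A noncommutative algebra satisfies the commutative centralizer condition if the centralizer of each of its non-central elements is a commutative algebra. A noncommutative algebra $A$ that admits the Dixmier partition satisfies the homogeneous centralizer condition if, for each $a\in A\setminus Z(A)$, the elements of $C(a)\setminus Z(A)$ are of exactly one of the following kinds: (1) all strongly nilpotent; (2) all weakly nilpotent; (3) all generic except for a subset $K^*a'+Z(A)$ of strongly semi-simple elements, for some $a'\in\Delta_3(A)$; (4) all generic except for a subset $K^*a'+Z(A)$ of weakly semi-simple elements, for some $a'\in\Delta_4(A)$; (5) all generic. *)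

(* Defs.v *)
From HB Require Import structures.
From mathcomp Require Import all_boot all_order all_algebra.
From mathcomp Require Import all_classical all_reals all_analysis.

Set Implicit Arguments.
Unset Strict Implicit.
Unset Printing Implicit Defensive.

Import Order.TTheory GRing.Theory Num.Theory.

Local Open Scope ring_scope.
Local Open Scope classical_set_scope.
Local Open Scope quotient_scope.

(* [algType K] is the type of nonzero associative unital K-algebras, and
   [{lrmorphism A -> B}] that of unital K-algebra homomorphisms. *)

Section LinearAlgebra.
Context {K : fieldType} {V : lmodType K}.

Definition lspan (S : set V) : set V :=
  [set v | exists s : seq (K * V),
     (forall p, p \in s -> S p.2) /\ v = \sum_(p <- s) p.1 *: p.2].

Definition lindep_free n (e : n.-tuple V) : Prop :=
  forall c : 'I_n -> K,
    \sum_(i < n) c i *: tnth e i = 0 -> forall i, c i = 0.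

Definition has_dim (W : set V) (n : nat) : Prop :=
  exists2 e : n.-tuple V, lindep_free e & lspan [set` e] = W.

Definition finite_dimensional (W : set V) : Prop := exists n, has_dim W n.

(* Junk value 0 when W is not a finite-dimensional subspace. *)
Definition vdim (W : set V) : nat := xget 0%N [set n | has_dim W n].

End LinearAlgebra.

(* The supremum over the finite-dimensional subspaces V = span(s) of
   limsup_n log (dim (V^0 + V^1 + ... + V^n)) / log n; [growth_space s n] is
   V^0 + ... + V^n, spanned by the words of length at most n in s. *)

Section GelfandKirillov.
Context {K : fieldType} (A : algType K).

Definition growth_space (s : seq A) (n : nat) : set A :=
  lspan [set v | exists2 w : seq A,
           {subset w <= s} /\ (size w <= n)%N & v = \prod_(u <- w) u].

Definition GKdim (R : realType) : \bar R :=
  ereal_sup [set limn_esup (fun n : nat =>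
      (ln (vdim (growth_space s n))%:R / ln n%:R)%:E) | s in [set: seq A]].

End GelfandKirillov.

(* [tens iota A] is L ⊗_K A, where L is a K-space through [iota]: formal sums
   of pure tensors [(l, a)], two of which are identified when every K-balanced
   biadditive map into an abelian group takes the same value on them.  The
   universal property of the tensor product is [tens_univ].  It carries the
   product and the L-scaling of the usual L-algebra structure
   ([tens_scalerAl], [tens_scalerAr]); it is only declared as a [pzRingType]
   and an [lmodType L], because [algType] would require a proof of 1 != 0. *)

Section ScalarExtension.
Context {K L : fieldType} (iota : {rmorphism K -> L}) (A : algType K).

Definition balanced (M : zmodType) (beta : L -> A -> M) : Prop :=
  [/\ forall l m a, beta (l + m) a = beta l a + beta m a,
      forall l a b, beta l (a + b) = beta l a + beta l b
    & forall c l a, beta (iota c * l) a = beta l (c *: a)].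

Definition teval (M : zmodType) (beta : L -> A -> M) (s : seq (L * A)) : M :=
  \sum_(p <- s) beta p.1 p.2.

Definition tens_eq : rel (seq (L * A)) := fun s t =>
  `[< forall (M : zmodType) (beta : L -> A -> M),
        balanced beta -> teval beta s = teval beta t >].

Lemma tens_eqP s t :
  reflect (forall (M : zmodType) (beta : L -> A -> M),
             balanced beta -> teval beta s = teval beta t) (tens_eq s t).
Proof. exact: asboolP. Qed.

Lemma tens_eq_is_equiv : equiv_class_of tens_eq.
Proof.
split.
- by move=> s; apply/tens_eqP.
- by move=> s t; apply/tens_eqP/tens_eqP => H M beta Hb; rewrite H.
- move=> t s u /tens_eqP H1 /tens_eqP H2; apply/tens_eqP => M beta Hb.
  by rewrite H1 // H2.
Qed.

Canonical tens_eq_equiv := EquivRelPack tens_eq_is_equiv.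
Canonical tens_eq_encModRel := defaultEncModRel tens_eq.

Definition tens := {eq_quot tens_eq}.
HB.instance Definition _ : EqQuotient _ tens_eq tens := EqQuotient.on tens.
HB.instance Definition _ := Choice.on tens.

Implicit Types (x y z : tens) (s t : seq (L * A)).

Definition tclass s : tens := \pi_tens s.
Definition tpure (l : L) (a : A) : tens := tclass [:: (l, a)].

Definition tzero : tens := tclass [::].
Definition tadd x y : tens := tclass (repr x ++ repr y).
Definition topp x : tens := tclass [seq (- p.1, p.2) | p <- repr x].
Definition tscale (c : L) x : tens := tclass [seq (c * p.1, p.2) | p <- repr x].
Definition tone : tens := tpure 1 1.
Definition tmul x y : tens :=
  tclass [seq (p.1 * q.1, p.2 * q.2) | p <- repr x, q <- repr y].

Definition tlift (M : zmodType) (beta : L -> A -> M) x : M :=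
  teval beta (repr x).

Lemma tens_ext x y :
  (forall (M : zmodType) (beta : L -> A -> M),
     balanced beta -> tlift beta x = tlift beta y) -> x = y.
Proof.
move=> H; rewrite -[x]reprK -[y]reprK.
by apply/eqquotP/tens_eqP => M beta Hb; exact: H.
Qed.

Section Lift.
Context {M : zmodType} {beta : L -> A -> M} (bal : balanced beta).

Lemma balanced0l a : beta 0 a = 0.
Proof.
by case: bal => D _ _; apply: (addrI (beta 0 a)); rewrite -D !addr0.
Qed.

Lemma balancedNl l a : beta (- l) a = - beta l a.
Proof.
by case: bal => D _ _; apply/eqP; rewrite -addr_eq0 -D addNr balanced0l.
Qed.

Lemma tlift_class s : tlift beta (tclass s) = teval beta s.
Proof.
have : tclass (repr (tclass s)) = tclass s by exact: reprK.
by move=> /eqquotP/tens_eqP; exact.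
Qed.

Lemma tlift_pure l a : tlift beta (tpure l a) = beta l a.
Proof. by rewrite tlift_class /teval big_seq1. Qed.

Lemma tlift0 : tlift beta tzero = 0.
Proof. by rewrite tlift_class /teval big_nil. Qed.

Lemma tliftD x y : tlift beta (tadd x y) = tlift beta x + tlift beta y.
Proof. by rewrite tlift_class /teval big_cat. Qed.

Lemma tliftN x : tlift beta (topp x) = - tlift beta x.
Proof.
rewrite tlift_class /tlift /teval big_map -sumrN.
by apply: eq_bigr => p _; rewrite balancedNl.
Qed.

Lemma tliftZ c x : tlift beta (tscale c x) = tlift (fun l => beta (c * l)) x.
Proof. by rewrite tlift_class /tlift /teval big_map. Qed.

Lemma tliftM x y : tlift beta (tmul x y) =
  tlift (fun l a => tlift (fun m b => beta (l * m) (a * b)) y) x.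
Proof. by rewrite tlift_class /tlift /teval big_allpairs_dep. Qed.

Lemma balanced_scale c : balanced (fun l => beta (c * l)).
Proof.
case: bal => Dl Dr B; split=> *; rewrite ?mulrDr ?Dl ?Dr //.
by rewrite mulrCA B.
Qed.

Lemma balanced_mul l a : balanced (fun m b => beta (l * m) (a * b)).
Proof.
case: bal => Dl Dr B; split=> *; rewrite ?mulrDr ?Dl ?Dr //.
by rewrite mulrCA B scalerAr.
Qed.

Lemma balanced_mull y :
  balanced (fun l a => tlift (fun m b => beta (l * m) (a * b)) y).
Proof.
case: bal => Dl Dr B; rewrite /tlift /teval; split=> [l m a|l a b|c l a].
- by rewrite -big_split; apply: eq_bigr => p _; rewrite mulrDl Dl.
- by rewrite -big_split; apply: eq_bigr => p _; rewrite mulrDl Dr.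
- by apply: eq_bigr => p _; rewrite -mulrA B scalerAl.
Qed.

End Lift.

Lemma eq_tlift (M : zmodType) (beta gam : L -> A -> M) x :
  (forall l a, beta l a = gam l a) -> tlift beta x = tlift gam x.
Proof. by move=> H; apply: eq_bigr => p _; rewrite H. Qed.

Lemma tlift_add (M : zmodType) (beta gam : L -> A -> M) x :
  tlift (fun l a => beta l a + gam l a) x = tlift beta x + tlift gam x.
Proof. by rewrite /tlift /teval big_split. Qed.

Lemma taddA : associative tadd.
Proof. by move=> x y z; apply: tens_ext => M b Hb; rewrite !tliftD // addrA. Qed.

Lemma taddC : commutative tadd.
Proof. by move=> x y; apply: tens_ext => M b Hb; rewrite !tliftD // addrC. Qed.

Lemma tadd0 : left_id tzero tadd.
Proof. by move=> x; apply: tens_ext => M b Hb; rewrite tliftD // tlift0 // add0r. Qed.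

Lemma taddN : left_inverse tzero topp tadd.
Proof.
by move=> x; apply: tens_ext => M b Hb; rewrite tliftD // tliftN // tlift0 // addNr.
Qed.

HB.instance Definition _ := GRing.isZmodule.Build tens taddA taddC tadd0 taddN.

Lemma tmulA : associative tmul.
Proof.
move=> x y z; apply: tens_ext => M b Hb.
rewrite !tliftM //; last exact: balanced_mull.
apply: eq_tlift => l a; rewrite tliftM //; last exact: balanced_mul.
by do 2!apply: eq_tlift => ? ?; rewrite !mulrA.
Qed.

Lemma tmul1x : left_id tone tmul.
Proof.
move=> x; apply: tens_ext => M b Hb.
rewrite tliftM // tlift_pure; last exact: balanced_mull.
by apply: eq_tlift => l a; rewrite !mul1r.
Qed.

Lemma tmulx1 : right_id tone tmul.
Proof.
move=> x; apply: tens_ext => M b Hb; rewrite tliftM //.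
apply: eq_tlift => l a; rewrite tlift_pure; last exact: balanced_mul.
by rewrite !mulr1.
Qed.

Lemma tmulDl : left_distributive tmul +%R.
Proof.
move=> x y z; apply: tens_ext => M b Hb.
by rewrite !(tliftM, tliftD) //; exact: balanced_mull.
Qed.

Lemma tmulDr : right_distributive tmul +%R.
Proof.
move=> x y z; apply: tens_ext => M b Hb.
rewrite !(tliftM, tliftD) // -tlift_add.
by apply: eq_tlift => l a; rewrite tliftD //; exact: balanced_mul.
Qed.

HB.instance Definition _ :=
  GRing.Zmodule_isPzRing.Build tens tmulA tmul1x tmulx1 tmulDl tmulDr.

Lemma tscaleA c d x : tscale c (tscale d x) = tscale (c * d) x.
Proof.
apply: tens_ext => M b Hb; rewrite !tliftZ //; last exact: balanced_scale.
by apply: eq_tlift => l a; rewrite mulrA.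
Qed.

Lemma tscale1 : left_id 1 tscale.
Proof.
move=> x; apply: tens_ext => M b Hb; rewrite tliftZ //.
by apply: eq_tlift => l a; rewrite mul1r.
Qed.

Lemma tscaleDr : right_distributive tscale +%R.
Proof.
move=> c x y; apply: tens_ext => M b Hb.
by rewrite !(tliftZ, tliftD) //; exact: balanced_scale.
Qed.

Lemma tscaleDl x : {morph tscale^~ x : c d / c + d}.
Proof.
move=> c d; apply: tens_ext => M b Hb; rewrite tliftD // !tliftZ // -tlift_add.
by apply: eq_tlift => l a; rewrite mulrDl; case: Hb => ->.
Qed.

HB.instance Definition _ := GRing.Zmodule_isLmodule.Build L tens
  tscaleA tscale1 tscaleDr tscaleDl.

Lemma tens_scalerAl (c : L) x y : c *: (x * y) = (c *: x) * y.
Proof.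
apply: tens_ext => M b Hb; rewrite (tliftZ Hb) (tliftM (balanced_scale Hb c)).
rewrite (tliftM Hb) (tliftZ (balanced_mull Hb y)).
by do 2!apply: eq_tlift => ? ?; rewrite !mulrA.
Qed.

Lemma tens_scalerAr (c : L) x y : c *: (x * y) = x * (c *: y).
Proof.
apply: tens_ext => M b Hb; rewrite (tliftZ Hb) (tliftM (balanced_scale Hb c)).
rewrite (tliftM Hb); apply: eq_tlift => l a.
rewrite (tliftZ (balanced_mul Hb l a)).
by apply: eq_tlift => m e; rewrite mulrCA.
Qed.

Lemma tpureM l m a b : tpure l a * tpure m b = tpure (l * m) (a * b).
Proof.
apply: tens_ext => M f Hf; rewrite (tliftM Hf) (tlift_pure (balanced_mull Hf _)).
by rewrite (tlift_pure (balanced_mul Hf _ _)) (tlift_pure Hf).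
Qed.

Lemma tpure_balanced : balanced tpure.
Proof.
split=> [l m a|l a b|c l a]; apply: tens_ext => M f Hf;
  rewrite ?(tliftD Hf) !(tlift_pure Hf); case: (Hf) => Dl Dr B.
- exact: Dl.
- exact: Dr.
- exact: B.
Qed.

Lemma tens_sum_pure x : x = \sum_(p <- repr x) tpure p.1 p.2.
Proof.
apply: tens_ext => M f Hf; rewrite {1}/tlift /teval.
elim: (repr x) => [|p s IH]; first by rewrite !big_nil (tlift0 Hf).
by rewrite !big_cons (tliftD Hf) (tlift_pure Hf) IH.
Qed.

Theorem tens_univ (M : zmodType) (beta : L -> A -> M) : balanced beta ->
  exists2 phi : {additive tens -> M},
    forall l a, phi (tpure l a) = beta l a
  & forall psi : {additive tens -> M},
      (forall l a, psi (tpure l a) = beta l a) -> psi =1 phi.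
Proof.
move=> Hb.
have tliftB : {morph tlift beta : x y / x - y}.
  by move=> x y; rewrite (tliftD Hb) (tliftN Hb).
pose phim := GRing.isZmodMorphism.Build tens M (tlift beta) tliftB.
pose phi : {additive tens -> M} := HB.pack (tlift beta) phim.
have phiE l a : phi (tpure l a) = beta l a by exact: tlift_pure.
exists phi => // psi psiE x; rewrite [x]tens_sum_pure !raddf_sum.
by apply: eq_bigr => p _; rewrite psiE phiE.
Qed.

End ScalarExtension.

Definition ad (R : pzRingType) (a b : R) : R := a * b - b * a.

Definition center (R : pzRingType) : set R := [set z | forall b, ad z b = 0].

Definition centralizer (R : pzRingType) (a : R) : set R := [set b | ad a b = 0].

Definition nilspace (R : pzRingType) (a : R) : set R :=
  \bigcup_i [set b | iter i.+1 (ad a) b = 0].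

Definition noncommutative (R : pzRingType) : Prop :=
  exists a b : R, a * b <> b * a.

Section DixmierPartition.
Context {K Kbar : fieldType} (iota : {rmorphism K -> Kbar}) {A : algType K}.
Implicit Types a b : A.

(* b is a finite sum of eigenvectors of ad (1 ⊗ a) in the scalar extension;
   the list [s] records the pairs (eigenvalue, eigenvector). *)
Definition eigenspace_sum a : set A :=
  [set b | exists s : seq (Kbar * tens iota A),
     (forall p, p \in s -> ad (tpure iota 1 a) p.2 = p.1 *: p.2) /\
     tpure iota 1 b = \sum_(p <- s) p.2].

(* K[ad a] b *)
Definition ad_orbit a b : set A :=
  [set \sum_(i < size p) p`_i *: iter i (ad a) b | p in [set: {poly K}]].

Definition finspace a : set A := [set b | finite_dimensional (ad_orbit a b)].

Local Notation Z := (@center A).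
Local Notation C := (@centralizer A).
Local Notation N := (@nilspace A).
Local Notation D := eigenspace_sum.
Local Notation F := finspace.

Definition strongly_nilpotent : set A :=
  [set a | [/\ ~ Z a, N a = setT & D a = C a]].

Definition weakly_nilpotent : set A :=
  [set a | [/\ ~ Z a, C a <> N a, N a <> setT & D a = C a]].

Definition strongly_semisimple : set A :=
  [set a | [/\ ~ Z a, N a = C a & D a = setT]].

Definition weakly_semisimple : set A :=
  [set a | [/\ ~ Z a, N a = C a, C a <> D a, D a = F a & F a <> setT]].

Definition generic : set A :=
  [set a | [/\ ~ Z a, N a = D a & D a = C a]].

End DixmierPartition.

Section Conditions.
Context {K Kbar : fieldType} (iota : {rmorphism K -> Kbar}) (A : algType K).
Local Notation Z := (@center A).

Definition dixmier_partition : Prop :=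
  ~` Z = strongly_nilpotent iota `|` weakly_nilpotent iota
         `|` strongly_semisimple iota `|` weakly_semisimple iota
         `|` generic iota.

(* K^* a + Z(A) *)
Definition punctured_line (a : A) : set A :=
  [set b | exists (c : K) (z : A), [/\ c != 0, Z z & b = c *: a + z]].

(* All elements of S are generic except for the subset K^* a' + Z(A) of S,
   which consists of elements of T, for some a' in T. *)
Definition generic_except (T S : set A) : Prop :=
  exists a' : A, [/\ T a',
    punctured_line a' `<=` S `&` T
  & S `\` punctured_line a' `<=` generic iota].

Definition centralizer_kind (a : A) (i : 'I_5) : Prop :=
  let S := centralizer a `\` Z in
  nth False [:: S `<=` strongly_nilpotent iota;
                S `<=` weakly_nilpotent iota;
                generic_except (strongly_semisimple iota) S;
                generic_except (weakly_semisimple iota) S;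
                S `<=` generic iota] i.

Definition homogeneous_centralizers : Prop :=
  [/\ noncommutative A, dixmier_partition
    & forall a : A, ~ Z a -> exists! i : 'I_5, centralizer_kind a i].

Definition commutative_centralizers : Prop :=
  noncommutative A /\
  forall a : A, ~ Z a -> forall b c,
    centralizer a b -> centralizer a c -> b * c = c * b.

End Conditions.

Definition is_algebraic_closure (K : fieldType) (Kbar : closedFieldType)
    (iota : {rmorphism K -> Kbar}) : Prop :=
  forall z : Kbar, algebraicOver iota z.

(* The universal property of K<x, y | rel>: a homomorphism out of A is the
   same as a pair of elements satisfying the relations. *)
Definition presented_by (K : fieldType)
    (rel : forall B : algType K, B -> B -> Prop) (A : algType K) (x y : A)
    : Prop :=
  rel A x y /\
  forall (B : algType K) (u v : B), rel B u v ->
    exists2 phi : {lrmorphism A -> B}, phi x = u /\ phi y = v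
    & forall psi : {lrmorphism A -> B}, psi x = u -> psi y = v -> psi =1 phi.

(* K<x, y | x y = lambda y x> *)
Definition quantum_plane (K : fieldType) (lambda : K) (A : algType K) (x y : A)
    : Prop :=
  presented_by (fun (B : algType K) (u v : B) => u * v = lambda *: (v * u)) x y.

(* K<x, d | d x - mu x d = 1> *)
Definition quantum_weyl (K : fieldType) (mu : K) (A : algType K) (x d : A)
    : Prop :=
  presented_by (fun (B : algType K) (u v : B) => v * u - mu *: (u * v) = 1) x d.

Definition division_ring (Q : unitRingType) : Prop :=
  forall q : Q, q != 0 -> q \is a GRing.unit.

(* Every element of Q is a right fraction j(a) j(b)^-1; [/] is u * v^-1. *)
Definition division_ring_of_fractions (K : fieldType) (A : algType K)
    (Q : unitAlgType K) (j : {lrmorphism A -> Q}) : Prop :=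
  [/\ division_ring Q, injective j
    & forall q : Q, exists a b : A, b != 0 /\ q = j a / j b].

(* Main.v *)
Require Import Defs.
From HB Require Import structures.
From mathcomp Require Import all_boot all_order all_algebra.
From mathcomp Require Import all_classical all_reals all_analysis.
From mathcomp Require Import zify ring.

(** Every noncentral element of every algebra in the theorem is generic; this
    gives all the conditions at once.  The common setting is a division ring
    [Q] containing nonzero [X], [Y] with [X Y = q Y X], [q] not a root of unity,
    such that every element of [Q] is a fraction of Laurent polynomials in [X]
    and [Y].  For the quantum plane take [X = x], [Y = y].  For the quantum Weyl
    algebra take [X = x] and [Y = dx - xd = 1 + (mu - 1) xd]: then
    [Y x = mu x Y], and [d] is a Laurent polynomial in [X] and [Y].

    Order the exponents in Z^2 lexicographically.  Distinct monomials have
    distinct characters under conjugation by [X] and [Y], so they are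
    independent ([const_tspan_nz]); hence a Laurent polynomial has a leading
    term, and passing to fractions makes the leading exponent a valuation of [Q]
    with values in Z^2 and residue field [K] ([lead], [lead_ex]).  Its key
    feature ([lead_ad]) is that if the leading exponents [g], [h] of [a], [b]
    are not parallel, then [ad a b] has leading exponent [g + h].

    Let [a] be a nonscalar element of [Q] and let [F(a)] be the set of [b] whose
    orbit under [ad a] spans a finite-dimensional space.  It is a subring by the
    Leibniz rule.  Subtracting a scalar from [a], which does not change [ad a],
    makes the leading exponent [g] of [a] nonzero.  If [b] in [F(a)] had a
    leading exponent [h] not parallel to [g], the iterates of [ad a] on [b]
    would have the distinct exponents [k g + h], hence be independent.  So the
    exponents occurring in [F(a)] lie on the line of [g] ([adfin_parallel]);
    they form a monoid which contains [g] and [- g], because [a] and its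
    inverse are in [F(a)], and therefore a cyclic group generated by the
    exponent of some [e] in [F(a)].  Since the residue field is [K], elements
    of [F(a)] of nonnegative value are approximated by polynomials in [e] to any
    order, and this forces [F(a)] to be commutative ([discrete_comm],
    [adfin_comm_adfin]).  As [a] is in [F(a)], [F(a) = C(a)].

    For [a] noncentral in a noncommutative subalgebra of [Q], [a] is not a
    scalar, and [N(a)] is obviously inside [F(a)].  So is [D(a)]: the
    eigenvalues are algebraic over [K], so some nonzero polynomial over [K] in
    [ad a] kills the given element after scalar extension, and the map from
    the algebra into its scalar extension is injective
    ([eigenspace_sum_adfin]).  Hence [N(a) = D(a) = C(a)] and [C(a)] is
    commutative.  A centralizer consisting of generic noncentral elements is of
    the fifth kind and of no other ([unique_centralizer_kind]). *)

Set Implicit Arguments.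
Unset Strict Implicit.
Unset Printing Implicit Defensive.

Import Order.TTheory GRing.Theory Num.Theory.

Local Open Scope ring_scope.

(** * Elements with finite-dimensional orbit under an inner derivation *)

Section FiniteAdjointOrbits.
Context {K : fieldType} {Q : algType K}.
Implicit Types (a b c : Q).

Lemma adD a b c : ad a (b + c) = ad a b + ad a c.
Proof. by rewrite /ad mulrDr mulrDl opprD addrACA. Qed.

Lemma ad0 a : ad a 0 = 0.
Proof. by rewrite /ad mulr0 mul0r subrr. Qed.

Lemma adZ a k b : ad a (k *: b) = k *: ad a b.
Proof. by rewrite /ad -scalerAr -scalerAl scalerBr. Qed.

Lemma ad_sum a (I : Type) (r : seq I) (F : I -> Q) :
  ad a (\sum_(i <- r) F i) = \sum_(i <- r) ad a (F i).
Proof. exact: (big_morph (ad a) (adD a) (ad0 a)). Qed.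

Lemma adM a b c : ad a (b * c) = ad a b * c + b * ad a c.
Proof. by rewrite /ad mulrBl mulrBr !mulrA addrA subrK. Qed.

Lemma ad_subC a k b : ad (a - k%:A) b = ad a b.
Proof.
rewrite /ad mulrBl mulrBr -scalerAl -scalerAr mul1r mulr1.
by rewrite opprB addrA subrK.
Qed.

Lemma iter_ad0 a k : iter k (ad a) 0 = 0.
Proof. by elim: k => //= k ->; rewrite ad0. Qed.

Lemma iter_adD a k b c :
  iter k (ad a) (b + c) = iter k (ad a) b + iter k (ad a) c.
Proof. by elim: k => //= k ->; rewrite adD. Qed.

Lemma iter_adZ a k d b : iter k (ad a) (d *: b) = d *: iter k (ad a) b.
Proof. by elim: k => //= k ->; rewrite adZ. Qed.

Definition fspan (I : finType) (u : I -> Q) (v : Q) : Prop :=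
  exists c : I -> K, v = \sum_i c i *: u i.

Section Fspan.
Context (I : finType) (u : I -> Q).

Lemma fspan0 : fspan u 0.
Proof. by exists (fun=> 0); rewrite big1 // => i _; rewrite scale0r. Qed.

Lemma fspanD v w : fspan u v -> fspan u w -> fspan u (v + w).
Proof.
move=> [c ->] [d ->]; exists (fun i => c i + d i); rewrite -big_split.
by apply: eq_bigr => i _; rewrite scalerDl.
Qed.

Lemma fspanZ k v : fspan u v -> fspan u (k *: v).
Proof.
move=> [c ->]; exists (fun i => k * c i); rewrite scaler_sumr.
by apply: eq_bigr => i _; rewrite scalerA.
Qed.

Lemma fspan_sum (J : Type) (r : seq J) (P : pred J) (F : J -> Q) :
  (forall j, P j -> fspan u (F j)) -> fspan u (\sum_(j <- r | P j) F j).
Proof.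
move=> H; elim/big_rec: _ => [|j v Pj]; first exact: fspan0.
by apply: fspanD; exact: H.
Qed.

Lemma fspan_gen i : fspan u (u i).
Proof.
exists (fun j => (j == i)%:R); rewrite (bigD1 i) //= eqxx scale1r big1 ?addr0 //.
by move=> j /negPf ->; rewrite scale0r.
Qed.
End Fspan.

(** The element [b] lies in [F(a)].  Asking that the orbit be inside the span of
    some finite family, rather than for a basis, makes the stability under sums
    and products immediate. *)
Definition adfin a b : Prop :=
  exists (I : finType) (u : I -> Q), forall k, fspan u (iter k (ad a) b).

Lemma adfinD a b c : adfin a b -> adfin a c -> adfin a (b + c).
Proof.
move=> [I [u ub]] [J [v vc]].
exists (I + J)%type, (fun s => match s with inl i => u i | inr j => v j end) => k.
rewrite iter_adD; have [x ->] := ub k; have [y ->] := vc k.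
exists (fun s => match s with inl i => x i | inr j => y j end).
by rewrite big_sumType.
Qed.

Lemma adfinZ a d b : adfin a b -> adfin a (d *: b).
Proof.
by move=> [I [u ub]]; exists I, u => k; rewrite iter_adZ; apply: fspanZ.
Qed.

Lemma adfinB a b c : adfin a b -> adfin a c -> adfin a (b - c).
Proof. by move=> ab /(adfinZ (-1)); rewrite scaleN1r; exact: adfinD. Qed.

(** By the Leibniz rule, the products of iterates of [b] and [c] span an
    [ad a]-stable space. *)
Lemma adfinM a b c : adfin a b -> adfin a c -> adfin a (b * c).
Proof.
move=> [I [u ub]] [J [v vc]].
exists (I * J)%type, (fun p => u p.1 * v p.2) => k.
suff H i j : fspan (fun p : I * J => u p.1 * v p.2)
    (iter k (ad a) (iter i (ad a) b * iter j (ad a) c)) by exact: (H 0%N 0%N).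
elim: k i j => [|k IH] i j; last first.
  by rewrite iterSr adM iter_adD; apply: fspanD; [exact: (IH i.+1)|exact: (IH i j.+1)].
have [x ->] := ub i; have [y ->] := vc j; rewrite /= mulr_suml.
apply: fspan_sum => s _; rewrite mulr_sumr; apply: fspan_sum => t _.
rewrite -scalerAl -scalerAr; do 2!apply: fspanZ.
exact: (@fspan_gen _ (fun p : I * J => u p.1 * v p.2) (s, t)).
Qed.

Lemma adfin_comm a b : ad a b = 0 -> adfin a b.
Proof.
move=> ab; exists unit, (fun=> b) => -[|k]; first exact: (fspan_gen _ tt).
by rewrite iterSr ab iter_ad0; exact: fspan0.
Qed.

(** More iterates than generators of the span are linearly dependent. *)
Lemma adfin_relation a b : adfin a b -> exists n (r : 'rV[K]_n),
  r != 0 /\ \sum_(k < n) r 0 k *: iter k (ad a) b = 0.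
Proof.
move=> [I [u /choice[c cE]]].
pose C := \matrix_(k < #|I|.+1, j < #|I|) c k (enum_val j).
have : kermx C != 0.
  by rewrite -mxrank_eq0 mxrank_ker subn_eq0 -ltnNge ltnS rank_leq_col.
rewrite -nz_row_eq0 => r0; exists #|I|.+1, (nz_row (kermx C)); split=> //.
have rC : nz_row (kermx C) *m C = 0 by apply/sub_kermxP/nz_row_sub.
set r := nz_row _ in rC *.
transitivity (\sum_(k < #|I|.+1) \sum_i (r 0 k * c k i) *: u i).
  by apply: eq_bigr => k _; rewrite cE scaler_sumr; apply: eq_bigr => i _; rewrite scalerA.
rewrite exchange_big big1 // => i _; rewrite -scaler_suml.
have /matrixP /(_ 0 (enum_rank i)) := rC; rewrite !mxE => E.
rewrite -[RHS](scale0r (u i)) -[in RHS]E; congr (_ *: _).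
by apply: eq_bigr => k _; rewrite !mxE enum_rankK.
Qed.

(** The span of the iterates below the degree of [p] is stable under [ad a], as
    the relation expresses the next iterate. *)
Lemma adfin_poly a b (p : {poly K}) : p != 0 ->
  \sum_(i < size p) p`_i *: iter i (ad a) b = 0 -> adfin a b.
Proof.
move=> p0 pE; set n := (size p).-1.
have sp : size p = n.+1 by rewrite /n prednK // lt0n size_poly_eq0.
pose u (i : 'I_n) := iter i (ad a) b; exists 'I_n, u.
have top : fspan u (iter n (ad a) b).
  move: pE; rewrite sp big_ord_recr /=.
  move=> /(congr1 ( *:%R (p`_n)^-1)); rewrite scaler0 scalerDr scalerA.
  have pn : p`_n != 0 by rewrite -lead_coefE lead_coef_eq0.
  rewrite mulVf // scale1r => /eqP; rewrite addrC addr_eq0 => /eqP ->.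
  rewrite -scaleN1r; do 2!apply: fspanZ; apply: fspan_sum => i _.
  by apply: fspanZ; exact: (fspan_gen u i).
elim=> [|k [c /= ->]].
  by move: @u top; case: (n) => [//|m] u _; exact: (fspan_gen u ord0).
rewrite ad_sum; apply: fspan_sum => i _; rewrite adZ; apply: fspanZ.
rewrite /u -iterS; case: (ltngtP i.+1 n) (ltn_ord i) => // [lt _|-> _ //].
exact: (fspan_gen u (Ordinal lt)).
Qed.
End FiniteAdjointOrbits.

(** * The ordered group of exponents *)

(** The positive cone of the lexicographic order on Z^2. *)
Definition pos (g : int * int) : bool :=
  (0 < g.1) || (g.1 == 0) && (0 < g.2).

Lemma posD g h : pos g -> pos h -> pos (g + h).
Proof. by rewrite /pos /=; case: g h => [g1 g2] [h1 h2] /=; lia. Qed.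

Lemma pos_neq0 g : pos g -> g != 0.
Proof. by apply: contraTneq => ->; rewrite /pos. Qed.

Lemma pos_total g : g != 0 -> pos g || pos (- g).
Proof. by case: g => [g1 g2]; rewrite /pos -pair_eqE /pair_eq /=; lia. Qed.

Definition ray (w : int * int) (m : int) : int * int := (w.1 * m, w.2 * m).

Lemma rayD w m n : ray w (m + n) = ray w m + ray w n.
Proof. by rewrite /ray !mulrDr. Qed.

Lemma rayN w m : ray w (- m) = - ray w m.
Proof. by rewrite /ray !mulrN. Qed.

Lemma ray0 w : ray w 0 = 0.
Proof. by rewrite /ray !mulr0. Qed.

Lemma ray1 w : ray w 1 = w.
Proof. by rewrite /ray !mulr1; case: w. Qed.

Lemma rayM w m n : ray (ray w m) n = ray w (m * n).
Proof. by rewrite /ray /= !mulrA. Qed.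

Lemma pos_ray w m : pos w -> pos (ray w m) = (0 < m).
Proof.
rewrite /pos /ray /= => /orP[w1|/andP[/eqP -> w2]].
  by rewrite pmulr_rgt0 // mulf_eq0 gt_eqF //=; have [->|] := eqVneq m 0;
    rewrite ?mulr0 ?orbF.
by rewrite mul0r ltxx eqxx /= pmulr_rgt0.
Qed.

(** The vectors parallel to [g] are the integer multiples of a primitive vector:
    divide [g] by the gcd of its coordinates; the multiple is read off with the
    Bezout coefficients. *)
Lemma parallel_ray g : g != 0 -> exists w : int * int, exists n : int,
  [/\ pos w, n != 0, g = ray w n
    & forall h, g.1 * h.2 = g.2 * h.1 -> exists m, h = ray w m].
Proof.
case: g => [g1 g2] g0; have [u [v uv]] := Bezoutz g1 g2.
set d := gcdz g1 g2 in uv.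
have d0 : d != 0.
  by rewrite gcdz_eq0; apply: contra g0 => /andP[/eqP -> /eqP ->].
have /dvdzP[w1 E1] : (d %| g1)%Z by exact: dvdz_gcdl.
have /dvdzP[w2 E2] : (d %| g2)%Z by exact: dvdz_gcdr.
have w1E : u * w1 + v * w2 = 1.
  by apply: (mulIf d0); rewrite mulrDl -!mulrA -E1 -E2 mul1r.
have par h : g1 * h.2 = g2 * h.1 -> h = ray (w1, w2) (u * h.1 + v * h.2).
  case: h => [h1 h2] /=; rewrite E1 E2 ![_ * d]mulrC -!mulrA => /(mulfI d0) E.
  rewrite /ray /=; congr (_, _).
    transitivity ((u * w1 + v * w2) * h1); first by rewrite w1E mul1r.
    by rewrite mulrDl mulrDr -[v * w2 * h1]mulrA -E; ring.
  transitivity ((u * w1 + v * w2) * h2); first by rewrite w1E mul1r.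
  by rewrite mulrDl mulrDr -[u * w1 * h2]mulrA E; ring.
have gE : (g1, g2) = ray (w1, w2) d by rewrite /ray /= -E1 -E2.
have w0 : (w1, w2) != 0.
  by apply: contraNneq g0 => w0; rewrite gE w0 /ray /= !mul0r.
case/orP: (pos_total w0) => pw.
  by exists (w1, w2), d; split=> // h /par hE; exists (u * h.1 + v * h.2).
have rN m : ray (w1, w2) m = ray (- (w1, w2)) (- m) by rewrite /ray /= !mulrNN.
exists (- (w1, w2)), (- d); rewrite oppr_eq0; split=> //; first by rewrite -rN.
by move=> h /par hE; exists (- (u * h.1 + v * h.2)); rewrite -rN.
Qed.

(** A submonoid of the integers meeting both signs is a group: with [n] and [- n]
    in [H], the opposite of [h] is [(|n| - 1) h - |n| h].  Euclidean division by
    the least positive element concludes. *)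
Lemma int_monoid_generator (H : int -> Prop) n :
  n != 0 -> H n -> H (- n) -> (forall k m, H k -> H m -> H (k + m)) ->
  exists h, [/\ 0 < h, H h & forall m, H m -> exists k, m = h * k].
Proof.
move=> n0 Hn HNn HD.
have H0 : H 0 by rewrite -(subrr n); exact: HD.
have HM (m : int) (k : nat) : H m -> H (m * k%:Z).
  move=> Hm; elim: k => [|k IH]; first by rewrite mulr0.
  by rewrite intS mulrDr mulr1; exact: HD.
have [N [N0 HN HNN]] : exists N : nat, [/\ (0 < N)%N, H N%:Z & H (- N%:Z)].
  exists `|n|%N; rewrite absz_gt0; split=> //; rewrite abszE.
    by case: (ger0P n).
  by case: (ger0P n) => // _; rewrite opprK.
have ex : exists k : nat, (0 < k)%N && `[< H k%:Z >].
  by exists N; rewrite N0; apply/asboolP.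
case: (ex_minnP ex) => h /andP[h0 /asboolP Hh] hmin.
have HNh : H (- h%:Z).
  have -> : - h%:Z = h%:Z * (N.-1)%:Z + (- N%:Z) * h%:Z.
    by case: (N) N0 => // M _ /=; rewrite intS; ring.
  by apply: HD; exact: HM.
have HMz (k : int) : H (h%:Z * k).
  case: k => k; first exact: HM.
  by rewrite NegzE mulrN -mulNr; exact: HM.
exists h%:Z; split=> // m Hm; exists (m %/ h)%Z.
have r0 : 0 <= (m %% h)%Z by rewrite modz_ge0 //; lia.
have rh : (m %% h)%Z < h by rewrite ltz_pmod.
have mE := divz_eq m h.
have Hr : H (m %% h)%Z.
  have -> : (m %% h)%Z = m + h%:Z * (- (m %/ h)%Z).
    by rewrite {2}mE; ring.
  exact: HD.
case: (m %% h)%Z r0 rh mE Hr => // r _ rh mE Hr.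
have r0 : r = 0%N.
  apply/eqP; rewrite -leqn0 leqNgt; apply/negP => r0.
  have /hmin : (0 < r)%N && `[< H r%:Z >] by rewrite r0; apply/asboolP.
  by move: rh; lia.
by rewrite {1}mE r0 addr0 mulrC.
Qed.

(** * Laurent polynomials in two q-commuting elements *)

Section QuantumTorus.
Context {K : fieldType} {Q : unitAlgType K}.

Lemma qcommV (u w : Q) (d : K) : d != 0 -> w \is a GRing.unit ->
  u * w = d *: (w * u) -> u * w^-1 = d^-1 *: (w^-1 * u).
Proof.
move=> d0 wU E; apply: (scalerI d0); rewrite scalerA mulfV // scale1r.
apply: (mulrI wU); rewrite -scalerAr [w * _]mulrA [w * (w^-1 * u)]mulrA mulrV //.
by rewrite mul1r scalerAl -E mulrK.
Qed.

Lemma qcommX (u w : Q) (d : K) (n : int) : d != 0 -> w \is a GRing.unit ->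
  u * w = d *: (w * u) -> u * w ^ n = d ^ n *: (w ^ n * u).
Proof.
move=> d0 wU E.
have nat_case (k : nat) : u * w ^+ k = d ^+ k *: (w ^+ k * u).
  elim: k => [|k IH]; first by rewrite !expr0 scale1r mulr1 mul1r.
  rewrite !exprSr mulrA IH -scalerAl -[_ * u * w]mulrA E.
  by rewrite -scalerAr scalerA mulrA.
case: n => k; first exact: nat_case.
by rewrite NegzE -!invr_expz; apply: qcommV;
  rewrite ?expf_neq0 ?unitrX //; exact: nat_case.
Qed.

Context (Qdiv : division_ring Q) (q : K) (q_neq0 : q != 0)
  (q_nroot : forall n, (0 < n)%N -> q ^+ n != 1)
  (X Y : Q) (X_neq0 : X != 0) (Y_neq0 : Y != 0)
  (XY : X * Y = q *: (Y * X)).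

Lemma XU : X \is a GRing.unit. Proof. exact: Qdiv. Qed.
Lemma YU : Y \is a GRing.unit. Proof. exact: Qdiv. Qed.

Lemma expz_eq1 (n : int) : q ^ n = 1 -> n = 0.
Proof.
case: n => n.
  by case: n => // n E; move: (q_nroot (ltn0Sn n)); rewrite -E eqxx.
rewrite NegzE -invr_expz => /(congr1 GRing.inv); rewrite invrK invr1 => E.
by move: (q_nroot (ltn0Sn n)); rewrite -E eqxx.
Qed.

Lemma expz_inj (m n : int) : q ^ m = q ^ n -> m = n.
Proof.
move=> E; apply/eqP; rewrite -subr_eq0; apply/eqP/expz_eq1.
by rewrite expfzDr // E -expfzDr // subrr.
Qed.

(** Locked, so that rewriting with associativity does not reassociate inside a
    monomial. *)
Definition mon (g : int * int) : Q := locked (X ^ g.1 * Y ^ g.2).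

Lemma monE g : mon g = X ^ g.1 * Y ^ g.2.
Proof. by rewrite /mon -lock. Qed.

Definition mtwist (g h : int * int) : K := q ^ (- (g.2 * h.1)).

Lemma mtwist_neq0 g h : mtwist g h != 0.
Proof. by rewrite expfz_neq0. Qed.

Lemma YX (j k : int) : Y ^ j * X ^ k = q ^ (- (j * k)) *: (X ^ k * Y ^ j).
Proof.
have E1 : Y * X = q^-1 *: (X * Y) by rewrite XY scalerA mulVf // scale1r.
have E2 := qcommX k (invr_neq0 q_neq0) XU E1.
have E3 : X ^ k * Y = q ^ k *: (Y * X ^ k).
  by rewrite E2 scalerA exprz_inv -expfzDr // subrr scale1r.
have E4 := qcommX j (expfz_neq0 k q_neq0) YU E3.
by rewrite E4 scalerA exprz_exp -expfzDr // [k * j]mulrC addNr expr0z scale1r.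
Qed.

Lemma monM g h : mon g * mon h = mtwist g h *: mon (g + h).
Proof.
rewrite !monE /= !exprzDr ?XU ?YU // -!mulrA [Y ^ g.2 * (X ^ h.1 * _)]mulrA YX.
by rewrite -scalerAl -scalerAr !mulrA.
Qed.

Lemma mon0 : mon 0 = 1.
Proof. by rewrite !monE /= !expr0z mulr1. Qed.

Lemma monU g : mon g \is a GRing.unit.
Proof.
by rewrite monE unitrMl /= ?unitrXz // ; apply: Qdiv.
Qed.
(** The Laurent polynomials with exponents in [P]. *)
Definition tspan (P : pred (int * int)) (t : Q) : Prop :=
  exists2 s : seq (K * (int * int)),
    all (fun p => P p.2) s & t = \sum_(p <- s) p.1 *: mon p.2.

Lemma tspan0 P : tspan P 0.
Proof. by exists [::]; rewrite ?big_nil. Qed.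

Lemma tspanD P t u : tspan P t -> tspan P u -> tspan P (t + u).
Proof.
move=> [s sP ->] [r rP ->]; exists (s ++ r); first by rewrite all_cat sP.
by rewrite big_cat.
Qed.

Lemma tspanZ P c t : tspan P t -> tspan P (c *: t).
Proof.
move=> [s sP ->]; exists [seq (c * p.1, p.2) | p <- s]; first by rewrite all_map.
by rewrite big_map scaler_sumr; apply: eq_bigr => p _; rewrite scalerA.
Qed.

Lemma tspanN P t : tspan P t -> tspan P (- t).
Proof. by rewrite -scaleN1r; exact: tspanZ. Qed.

Lemma tspan_mon (P : pred _) g : P g -> tspan P (mon g).
Proof. by move=> Pg; exists [:: (1, g)]; rewrite /= ?Pg // big_seq1 scale1r. Qed.

Lemma tspan1 : tspan predT 1.
Proof. by rewrite -mon0; exact: tspan_mon. Qed.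

Lemma tspanX : tspan predT X.
Proof.
have := @tspan_mon predT (1, 0) isT.
by rewrite monE /= expr0z mulr1 expr1z.
Qed.

Lemma tspanXV : tspan predT X^-1.
Proof.
have := @tspan_mon predT (-1, 0) isT.
by rewrite monE /= expr0z mulr1 exprN1.
Qed.

Lemma tspanY : tspan predT Y.
Proof.
have := @tspan_mon predT (0, 1) isT.
by rewrite monE /= expr0z mul1r expr1z.
Qed.

Lemma tspan_sum P (I : eqType) (r : seq I) (F : I -> Q) :
  (forall i, i \in r -> tspan P (F i)) -> tspan P (\sum_(i <- r) F i).
Proof.
move=> PF; rewrite big_seq; elim/big_rec: _ => [|i x /PF]; first exact: tspan0.
exact: tspanD.
Qed.

Lemma sub_tspan (P P' : pred _) t : {subset P <= P'} -> tspan P t -> tspan P' t.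
Proof.
by move=> sub [s /allP sP ->]; exists s => //; apply/allP => p /sP /sub.
Qed.

Lemma tspanM (P P' P'' : pred (int * int)) t u :
  (forall g h, P g -> P' h -> P'' (g + h)) ->
  tspan P t -> tspan P' u -> tspan P'' (t * u).
Proof.
move=> PP [s /allP sP ->] [r /allP rP ->]; rewrite mulr_suml.
apply: tspan_sum => p /sP Pp; rewrite mulr_sumr; apply: tspan_sum => e /rP Pe.
by rewrite -scalerAl -scalerAr monM; do 3!apply: tspanZ; apply/tspan_mon/PP.
Qed.

(** Independence of [1] from the other monomials.  Conjugation by [X] or [Y]
    fixes [c] and multiplies the monomial of exponent [g] by some [chi g], with
    [chi g != 1] for one of the two when [g != 0].  Subtracting [chi g] times
    the relation from its conjugate leaves a shorter relation for
    [(1 - chi g) c]. *)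
Lemma const_tspan_nz c : tspan (fun g => g != 0) c%:A -> c = 0.
Proof.
move=> [s]; move: {-1}(size s) (leqnn (size s)) => n.
elim: n s c => [|n IH] [|[d g] s] c //= sn => [_|_|/andP[g0 sP]].
  by rewrite big_nil => /eqP; rewrite scaler_eq0 oner_eq0 orbF => /eqP.
  by rewrite big_nil => /eqP; rewrite scaler_eq0 oner_eq0 orbF => /eqP.
rewrite big_cons /=.
set S := \sum_(_ <- _) _ => cE.
have conj (Z : Q) (chi : int * int -> K) : Z \is a GRing.unit ->
    (forall h, Z * mon h = chi h *: (mon h * Z)) -> chi g != 1 -> c = 0.
  move=> ZU ZE chig.
  have: (c - chi g * c)%:A
      = \sum_(p <- [seq ((chi p.2 - chi g) * p.1, p.2) | p <- s]) p.1 *: mon p.2.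
    apply: (mulIr ZU); rewrite scalerBl mulrBl -scalerA -!scalerAl mul1r big_map.
    rewrite mulr_suml.
    transitivity (Z * S - chi g *: (S * Z)).
      have -> : S = c%:A - d *: mon g by rewrite cE addrC addKr.
      rewrite mulrBr mulrBl scalerBr -!scalerAr -!scalerAl mulr1 mul1r ZE.
      by rewrite !scalerA [d * _]mulrC opprB addrA subrK.
    rewrite /S mulr_sumr mulr_suml scaler_sumr -sumrB.
    apply: eq_bigr => p _; rewrite -scalerAr ZE -!scalerAl !scalerA -scalerBl.
    by congr (_ *: _); rewrite mulrBl [p.1 * _]mulrC.
  move=> /IH; rewrite size_map all_map => /(_ sn sP) /eqP.
  rewrite -{1}[c]mul1r -mulrBl mulf_eq0 subr_eq0 eq_sym (negPf chig) /=.
  by move/eqP.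
have [g2|g2] := eqVneq g.2 0; last first.
  apply: (conj X (fun h => q ^ h.2)); rewrite ?XU //.
    move=> h; have -> : X = mon (1, 0) by rewrite monE /= expr1z expr0z mulr1.
    rewrite !monM /mtwist /= addrC mul0r oppr0 expr0z scale1r scalerA.
    by rewrite mulr1 -expfzDr // addrN expr0z scale1r.
  by apply: contra g2 => /eqP /expz_eq1 ->.
have g1 : g.1 != 0.
  by apply: contra g0 => /eqP g1; apply/eqP/injective_projections.
apply: (conj Y (fun h => q ^ (- h.1))); rewrite ?YU //.
  move=> h; have -> : Y = mon (0, 1) by rewrite monE /= expr1z expr0z mul1r.
  rewrite !monM /mtwist /= addrC mulr0 oppr0 expr0z scale1r.
  by rewrite mul1r.
apply: contra g1 => /eqP /expz_eq1 /eqP; by rewrite oppr_eq0.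
Qed.
Lemma monV g : tspan (pred1 (- g)) (mon g)^-1.
Proof.
have -> : (mon g)^-1 = (mtwist g (- g))^-1 *: mon (- g).
  apply: (mulrI (monU g)); rewrite mulrV ?monU // -scalerAr monM subrr mon0.
  by rewrite scalerA mulVf ?mtwist_neq0 // scale1r.
by apply/tspanZ/tspan_mon => /=.
Qed.

Lemma tspanT P t : tspan P t -> tspan predT t.
Proof. exact: sub_tspan. Qed.

Lemma tspanMT t u : tspan predT t -> tspan predT u -> tspan predT (t * u).
Proof. exact: tspanM. Qed.

Lemma tspanMpos t u : tspan pos t -> tspan pos u -> tspan pos (t * u).
Proof. by apply: tspanM => g h; exact: posD. Qed.

Lemma tspan_conj g t : tspan pos t -> tspan pos (mon g * t / mon g).
Proof.
move=> tp; apply: (@tspanM (fun h => pos (h - g)) (pred1 (- g))).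
- by move=> h k ph /eqP ->.
- apply: (@tspanM (pred1 g) pos) tp; last by apply: tspan_mon => /=.
  by move=> _ h /eqP -> ph; rewrite addrC addKr.
- exact: monV.
Qed.

Lemma const_tspan_pos c : tspan pos c%:A -> c = 0.
Proof. by move=> H; apply/const_tspan_nz/(sub_tspan pos_neq0 H). Qed.

(** Laurent polynomials with leading term [1]. *)
Definition tunit (t : Q) : Prop := tspan pos (t - 1).

Lemma tunit1 : tunit 1.
Proof. by rewrite /tunit subrr; exact: tspan0. Qed.

Lemma tunit_neq0 t : tunit t -> t != 0.
Proof.
move=> t1; apply/eqP => t0; move: t1; rewrite /tunit t0 sub0r => /tspanN.
rewrite opprK -[1]scale1r => /const_tspan_pos /eqP; by rewrite oner_eq0.
Qed.

Lemma tunitU t : tunit t -> t \is a GRing.unit.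
Proof. by move/tunit_neq0/Qdiv. Qed.

Lemma tunitM t u : tunit t -> tunit u -> tunit (t * u).
Proof.
move=> t1 u1; have -> : t * u = ((t - 1) * (u - 1) + (t - 1)) + (u - 1) + 1.
  by rewrite mulrBr mulr1 subrK mulrBl mul1r -addrA subrK subrK.
rewrite /tunit addrK; do 2?apply: tspanD => //; exact: tspanMpos.
Qed.

Lemma tunitMpos t u : tunit t -> tspan pos u -> tspan pos (t * u).
Proof.
move=> t1 up; rewrite -[t](subrK 1) mulrDl mul1r.
by apply: tspanD => //; exact: tspanMpos.
Qed.

Lemma tposMunit t u : tspan pos t -> tunit u -> tspan pos (t * u).
Proof.
move=> tp u1; rewrite -[u](subrK 1) mulrDr mulr1.
by apply: tspanD => //; exact: tspanMpos.
Qed.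

Lemma tunit_conj g t : tunit t -> tunit (mon g * t / mon g).
Proof.
move=> /(tspan_conj g); rewrite mulrBr mulr1 mulrBl mulrV ?monU //.
Qed.

Lemma list_min (s : seq (K * (int * int))) : s != [::] ->
  exists2 p, p \in s & forall r, r \in s -> (r.2 != p.2) ==> pos (r.2 - p.2).
Proof.
elim: s => // p s IH _; have [->|/IH [r rs rmin]] := eqVneq s [::].
  by exists p; rewrite ?mem_head // => r; rewrite inE => /eqP ->; rewrite eqxx.
have [pr|] := boolP (pos (p.2 - r.2) || (p.2 == r.2)).
  exists r => [|t]; first by rewrite inE rs orbT.
  rewrite inE => /predU1P [->|/rmin //]; apply/implyP.
  by case/orP: pr => // ->.
rewrite negb_or => /andP[npr pr]; exists p; first exact: mem_head.
move=> t; rewrite inE => /predU1P [->|/rmin]; first by rewrite eqxx.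
have rp : pos (r.2 - p.2).
  by have := @pos_total (p.2 - r.2); rewrite subr_eq0 opprB (negPf npr); apply.
have [->//|_ /= tr] := eqVneq t.2 r.2; first by rewrite rp implybT.
by have := posD tr rp; rewrite addrA subrK => ->; rewrite implybT.
Qed.

(** The minimal exponent of a representation gives the leading term, unless its
    total coefficient vanishes; then the remaining terms form a shorter
    representation. *)
Lemma tspan_lead t : tspan predT t -> t != 0 ->
  exists c g u, [/\ c != 0, tunit u & t = c *: (u * mon g)].
Proof.
move=> [s _]; move: {-1}(size s) (leqnn (size s)) => n.
elim: n s t => [|n IH] s t sn tE t0.
  by move: sn t0; rewrite leqn0 size_eq0 tE => /eqP ->; rewrite big_nil eqxx.
have s0 : s != [::] by apply: contraNneq t0 => s0; rewrite tE s0 big_nil.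
have [p ps pmin] := list_min s0; set g := p.2 in pmin *.
set R := \sum_(r <- s | r.2 != g) r.1 *: mon r.2.
set C := \sum_(r <- s | r.2 == g) r.1.
have {}tE : t = C *: mon g + R.
  rewrite tE (bigID (fun r : K * (int * int) => r.2 == g)) /= scaler_suml.
  by congr (_ + _); apply: eq_bigr => r /eqP ->.
have [C0|C0] := eqVneq C 0.
  apply: (IH [seq r <- s | r.2 != g]) => //; last first.
    by rewrite tE C0 scale0r add0r /R big_filter.
  rewrite size_filter -ltnS; apply: leq_trans sn.
  rewrite -(count_predC (fun r : K * (int * int) => r.2 != g) s).
  rewrite -addn1 leq_add2l -has_count.
  by apply/hasP; exists p => //=; rewrite negbK.
exists C, g, (1 + (C^-1 *: R) / mon g); split => //; last first.
  rewrite mulrDl mul1r mulrVK ?monU // scalerDr scalerA mulfV // scale1r //.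
rewrite /tunit addrC addKr.
apply: (@tspanM (fun h => pos (h - g)) (pred1 (- g))); last exact: monV.
  by move=> h k ph /eqP ->.
apply: tspanZ; rewrite /R -big_filter; apply: tspan_sum => r.
rewrite mem_filter => /andP[rg /pmin]; rewrite rg /= => pr.
exact/tspanZ/tspan_mon.
Qed.

(** If the leading exponent of [p] were not positive, neither would be that of
    [b * p], which is the same. *)
Lemma tunit_cancel_pos b p :
  tunit b -> tspan predT p -> tspan pos (b * p) -> tspan pos p.
Proof.
move=> b1 pT bp; have [->|p0] := eqVneq p 0; first exact: tspan0.
have [c [g [u [c0 u1 pE]]]] := tspan_lead pT p0.
have bu1 : tunit (b * u) := tunitM b1 u1.
have H (P : pred (int * int)) : tspan pos (b * p) ->
    (forall h, pos h -> P (h - g)) -> tspan P (c *: (b * u)).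
  move=> bp' PP; have -> : c *: (b * u) = b * p / mon g.
    by rewrite pE -scalerAr -scalerAl !mulrA mulrK ?monU.
  apply: (@tspanM pos (pred1 (- g))) bp' (monV g).
  by move=> h _ ph /eqP ->; exact: PP.
have npos : ~ tspan pos (c *: (b * u)).
  move=> /tspanD /(_ (tspanN (tspanZ c bu1))); rewrite scalerBr opprB.
  by rewrite addrC subrK => /const_tspan_pos /eqP; rewrite (negPf c0).
have pg : pos g.
  have [g0|/pos_total/orP[//|gN]] := eqVneq g 0.
    by case: npos; apply: H bp _ => h; rewrite g0 subr0.
  by case: npos; apply: H bp _ => h ph; exact: posD.
rewrite pE; apply: tspanZ; apply: tunitMpos => //; exact: tspan_mon.
Qed.

Context (Qfrac : forall z : Q, exists a b : Q,
  [/\ tspan predT a, tspan predT b, b != 0 & z = a / b]).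

(** The leading term of a denominator can be moved into the numerator. *)
Lemma frac_tunit (z : Q) : exists a b : Q,
  [/\ tspan predT a, tunit b & z = a / b].
Proof.
have [a [b [aT bT b0 ->]]] := Qfrac z.
have [c [g [u [c0 u1 ->]]]] := tspan_lead bT b0.
exists (c^-1 *: (a / mon g)), u; split=> //.
  by apply/tspanZ/tspanMT => //; exact/tspanT/monV.
have uU : u * mon g \is a GRing.unit by rewrite unitrMl ?monU ?tunitU.
rewrite invrZ ?unitfE // invrM ?monU ?tunitU //.
by rewrite -scalerAr -scalerAl mulrA.
Qed.

(** The Ore condition, read off from a fraction equal to [b^-1 * a]. *)
Lemma ore a b : tunit b -> exists p r : Q,
  [/\ tspan predT p, tunit r & a * r = b * p].
Proof.
move=> b1; have [p [r [pT r1 E]]] := frac_tunit (b^-1 * a).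
exists p, r; split=> //; apply: (mulrI (x := b^-1)); rewrite ?unitrV ?tunitU //.
by rewrite mulrA E mulrVK ?tunitU // mulKr ?tunitU.
Qed.

(** * The leading-exponent valuation of the division ring *)

(** The maximal ideal of the valuation ring. *)
Definition small (z : Q) : Prop :=
  exists a b : Q, [/\ tspan pos a, tunit b & z = a / b].

Lemma small_tspan a : tspan pos a -> small a.
Proof. by move=> ap; exists a, 1; split; rewrite ?divr1 //; exact: tunit1. Qed.

Lemma smallD z w : small z -> small w -> small (z + w).
Proof.
move=> [a [b [ap b1 ->]]] [a' [b' [ap' b1' ->]]].
have [p [r [pT r1 E]]] := ore b' b1.
have p1 : tunit p.
  apply: (@tunit_cancel_pos b) => //; first by apply: tspanD => //; exact/tspanN/tspan1.
  have -> : b * (p - 1) = (b' * r - 1) - (b - 1).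
    by rewrite mulrBr mulr1 -E opprB addrA subrK.
  by apply: tspanD; [exact: tunitM | exact: tspanN].
exists (a * p + a' * r), (b * p); split; last 1 first.
- rewrite mulrDl; congr (_ + _).
    by rewrite invrM ?tunitU // mulrA mulrK ?tunitU.
  by rewrite -E invrM ?tunitU // mulrA mulrK ?tunitU.
- by apply: tspanD; exact: tposMunit.
- exact: tunitM.
Qed.

Lemma smallM z w : small z -> small w -> small (z * w).
Proof.
move=> [a [b [ap b1 ->]]] [a' [b' [ap' b1' ->]]].
have [p [r [pT r1 E]]] := ore a' b1.
have pp : tspan pos p.
  by apply: (tunit_cancel_pos b1 pT); rewrite -E; exact: tposMunit.
exists (a * p), (b' * r); split; first exact: tspanMpos.
  exact: tunitM.
have -> : a / b * (a' / b') = a * (b^-1 * (a' * r)) / r / b'.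
  by rewrite !mulrA mulrK ?tunitU.
by rewrite E mulKr ?tunitU // invrM ?tunitU // !mulrA.
Qed.

Lemma smallZ c z : small z -> small (c *: z).
Proof.
by move=> [a [b [ap b1 ->]]]; exists (c *: a), b; rewrite scalerAl; split=> //;
  exact: tspanZ.
Qed.

Lemma small_conj g z : small z -> small (mon g * z / mon g).
Proof.
move=> [a [b [ap b1 ->]]]; exists (mon g * a / mon g), (mon g * b / mon g).
split; [exact: tspan_conj | exact: tunit_conj |].
have mbU : mon g * b \is a GRing.unit by rewrite unitrMl ?monU ?tunitU.
rewrite invrM ?unitrV ?monU // invrK invrM ?monU ?tunitU //.
by rewrite !mulrA !mulrVK ?monU // .
Qed.

Lemma const_small c : small c%:A -> c = 0.
Proof.
move=> [a [b [ap b1 E]]]; apply: const_tspan_pos.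
have -> : c%:A = a - c *: (b - 1).
  rewrite -(mulrVK (tunitU b1) a) -E -scalerAl mul1r scalerBr.
  by rewrite opprB addrC subrK.
by apply: tspanD => //; exact/tspanN/tspanZ.
Qed.
Lemma small0 : small 0.
Proof. exact/small_tspan/tspan0. Qed.

Lemma small_mon g : pos g -> small (mon g).
Proof. by move=> pg; exact/small_tspan/tspan_mon. Qed.

(** The value of [z] is at least [g], and the coefficient of the monomial of
    exponent [g] in [z] is [c].  Here [c] may be zero: the value of [z] is [g]
    exactly when [c != 0], while [lead z 0 g] says that it is larger. *)
Definition lead (z : Q) (c : K) (g : int * int) : Prop :=
  exists2 u, small u & z = (c%:A + u) * mon g.

Lemma lead0 g : lead 0 0 g.
Proof. by exists 0; [exact: small0 | rewrite scale0r addr0 mul0r]. Qed.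

Lemma leadD z w c d g : lead z c g -> lead w d g -> lead (z + w) (c + d) g.
Proof.
move=> [u us ->] [v vs ->]; exists (u + v); first exact: smallD.
by rewrite -mulrDl scalerDl addrACA.
Qed.

Lemma leadZ k z c g : lead z c g -> lead (k *: z) (k * c) g.
Proof.
move=> [u us ->]; exists (k *: u); first exact: smallZ.
by rewrite scalerAl scalerDr scalerA.
Qed.

Lemma leadB z w c d g : lead z c g -> lead w d g -> lead (z - w) (c - d) g.
Proof. by move=> zc /(leadZ (-1)); rewrite scaleN1r mulN1r; exact: leadD. Qed.

Lemma leadM z w c d g h : lead z c g -> lead w d h ->
  lead (z * w) (c * d * mtwist g h) (g + h).
Proof.
move=> [u us ->] [v vs ->]; set v' := mon g * v / mon g.
have v's : small v' by exact: small_conj.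
exists (mtwist g h *: (c *: v' + d *: u + u * v')).
  by apply: smallZ; apply: smallD; [apply: smallD; exact: smallZ | exact: smallM].
have -> : (c%:A + u) * mon g * ((d%:A + v) * mon h) =
    (c%:A + u) * (d%:A + v') * (mon g * mon h).
  rewrite !mulrA; congr (_ * _); rewrite -!mulrA; congr (_ * _).
  by rewrite mulrDr [RHS]mulrDl mulrVK ?monU // -scalerAl -scalerAr mulr1 mul1r.
rewrite monM -scalerAr scalerAl; congr (_ * _).
rewrite mulrC -scalerA -scalerDr; congr (_ *: _).
rewrite mulrDl !mulrDr -!scalerAl -!scalerAr !mul1r mulr1 scalerA -!addrA.
by congr (_ + _); rewrite addrA.
Qed.

Lemma lead_low z c g h : lead z c g -> pos (g - h) -> lead z 0 h.
Proof.
move=> [u us ->] pgh.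
exists ((mtwist (g - h) h)^-1 *: ((c%:A + u) * mon (g - h))).
  apply: smallZ; rewrite mulrDl -scalerAl mul1r.
  apply: smallD; first exact/smallZ/small_mon.
  by apply: smallM => //; exact: small_mon.
rewrite scale0r add0r -scalerAl -mulrA monM subrK -scalerAr scalerA.
by rewrite mulVf ?mtwist_neq0 // scale1r.
Qed.

Lemma lead_uniq z c d g : lead z c g -> lead z d g -> c = d.
Proof.
move=> [u us zE] [v vs]; rewrite {}zE => /(mulIr (monU g)) E.
apply/eqP; rewrite -subr_eq0; apply/eqP/const_small.
have -> : (c - d)%:A = v - u.
  by rewrite scalerBl; apply/eqP; rewrite subr_eq addrAC eq_sym subr_eq addrC -E addrC.
by apply: smallD => //; rewrite -scaleN1r; exact: smallZ.
Qed.

Lemma lead_ge z c d g h : c != 0 -> lead z c g -> lead z d h -> ~~ pos (h - g).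
Proof.
move=> c0 zc zd; apply/negP => /(lead_low zd) z0.
by rewrite (lead_uniq zc z0) eqxx in c0.
Qed.

Lemma lead_neq0 z c g : c != 0 -> lead z c g -> z != 0.
Proof.
move=> c0 zc; apply: contraNneq c0 => z0; rewrite z0 in zc.
exact/eqP/(lead_uniq zc)/lead0.
Qed.

Lemma lead_exp z c d g h : c != 0 -> d != 0 -> lead z c g -> lead z d h -> g = h.
Proof.
move=> c0 d0 zc zd; apply/eqP; rewrite -subr_eq0; apply: contraT => /pos_total.
by rewrite opprB (negPf (lead_ge c0 zc zd)) (negPf (lead_ge d0 zd zc)).
Qed.

Lemma lead_const c : lead c%:A c 0.
Proof. by exists 0; [exact: small0 | rewrite addr0 mon0 mulr1]. Qed.

Lemma lead_ex z : z != 0 -> exists c g, c != 0 /\ lead z c g.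
Proof.
move=> z0; have [a [b [aT b1 zE]]] := frac_tunit z.
have a0 : a != 0 by apply: contraNneq z0 => a0; rewrite zE a0 mul0r.
have [c [g [u [c0 u1 aE]]]] := tspan_lead aT a0.
exists c, g; split=> //.
set v := mon g * b / mon g; have v1 : tunit v by exact: tunit_conj.
exists (c *: ((u - v) / v)).
  apply: smallZ; exists (u - v), v; split=> //.
  have -> : u - v = (u - 1) - (v - 1) by rewrite opprB addrA subrK.
  by apply: tspanD => //; exact: tspanN.
rewrite mulrBl mulrV ?tunitU // -scalerDr addrC subrK -scalerAl zE aE.
rewrite -scalerAl -!mulrA; congr (_ *: (_ * _)).
apply: (mulrI (tunitU v1)); rewrite mulVKr ?tunitU //.
by rewrite /v !mulrA mulrVK ?monU // mulrK ?tunitU.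
Qed.

Lemma leadV z c g : c != 0 -> lead z c g ->
  exists2 d, d != 0 & lead z^-1 d (- g).
Proof.
move=> c0 zc; have z0 := lead_neq0 c0 zc.
have zU : z \is a GRing.unit by exact: Qdiv.
have [d [h [d0 zd]]] : exists c g, c != 0 /\ lead z^-1 c g.
  by apply: lead_ex; apply: contraNneq z0 => E; rewrite -[z]invrK E invr0.
exists d => //; have -> : - g = h; last by [].
apply/esym/eqP; rewrite -addr_eq0 addrC; apply/eqP.
have := leadM zc zd; rewrite mulrV // => /lead_exp; apply; last first.
- rewrite -[X in lead X]scale1r; exact: lead_const.
- exact: oner_neq0.
- by rewrite !mulf_neq0 ?mtwist_neq0.
Qed.

(** Leading monomials commute up to [q ^ (g.1 * h.2 - g.2 * h.1)], and [q] is not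
    a root of unity. *)
Lemma lead_ad a b c d g h : c != 0 -> d != 0 -> lead a c g -> lead b d h ->
  g.1 * h.2 != g.2 * h.1 -> exists2 e, e != 0 & lead (ad a b) e (g + h).
Proof.
move=> c0 d0 ac bd gh; exists (c * d * (mtwist g h - mtwist h g)).
  rewrite !mulf_neq0 // subr_eq0; apply: contra gh => /eqP /expz_inj /oppr_inj.
  by rewrite [h.2 * _]mulrC => ->.
rewrite mulrBr {2}[c * d]mulrC; apply: leadB; first exact: leadM.
by rewrite addrC; exact: leadM.
Qed.

(** Terms with distinct leading exponents cannot cancel. *)
Lemma lead_sum (I : eqType) (r : seq I) (v : I -> Q) (e : I -> K)
    (g : I -> int * int) : uniq r -> injective g -> r != [::] ->
  (forall i, i \in r -> e i != 0 /\ lead (v i) (e i) (g i)) ->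
  exists i d, [/\ i \in r, d != 0 & lead (\sum_(i <- r) v i) d (g i)].
Proof.
move=> + ginj; elim: r => // i r IH /= /andP[ir ru] _ H.
have [ei vi] := H i (mem_head _ _); rewrite big_cons.
have [->|r0] := eqVneq r [::].
  by exists i, (e i); rewrite big_nil addr0 mem_head.
have [|j [d [jr d0 vr]]] := IH ru r0.
  by move=> j jr; apply: H; rewrite inE jr orbT.
have : g i - g j != 0.
  by rewrite subr_eq0 (inj_eq ginj); apply: contraNneq ir => ->.
move=> /pos_total /orP[] pij.
  exists j, d; rewrite inE jr orbT; split=> //.
  by rewrite -[d]add0r; apply: leadD => //; apply: lead_low vi _.
exists i, (e i); rewrite mem_head; split=> //.
by rewrite -[e i]addr0; apply: leadD => //; apply: lead_low vr _; rewrite -opprB.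
Qed.
(** * Commutativity of the ring of elements with finite-dimensional orbit *)

Lemma lead_iter_ad a b c d g h k : c != 0 -> d != 0 ->
  lead a c g -> lead b d h -> g.1 * h.2 != g.2 * h.1 ->
  exists2 e, e != 0 & lead (iter k (ad a) b) e (ray g k%:Z + h).
Proof.
move=> c0 d0 ac bd gh; elim: k => [|k [e e0 be]].
  by exists d => //; rewrite ray0 add0r.
have [|f f0 bf] := lead_ad c0 e0 ac be; last first.
  by exists f => //; rewrite intS rayD ray1 -addrA.
rewrite -subr_eq0 in gh; rewrite -subr_eq0.
suff -> : g.1 * (ray g k%:Z + h).2 - g.2 * (ray g k%:Z + h).1 =
  g.1 * h.2 - g.2 * h.1 by [].
by rewrite /ray /=; move: k%:Z => z; ring.
Qed.

(** Otherwise the iterates of [ad a] on [b] have the distinct leading exponents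
    [k g + h], which excludes a linear relation between them. *)
Lemma adfin_parallel a b c d g h : c != 0 -> d != 0 -> g != 0 ->
  lead a c g -> lead b d h -> adfin a b -> g.1 * h.2 = g.2 * h.1.
Proof.
move=> c0 d0 g0 ac bd /adfin_relation [n [r [r0 rE]]].
apply/eqP; apply: contraT => gh.
have /choice [e eE] (k : nat) : exists e, e != 0 /\
    lead (iter k (ad a) b) e (ray g k%:Z + h).
  by have [e] := lead_iter_ad k c0 d0 ac bd gh; exists e.
pose s := [seq k <- enum 'I_n | r 0 k != 0].
have s0 : s != [::].
  apply: contra r0 => /eqP s0; apply/eqP/rowP => k; rewrite mxE; apply/eqP.
  apply: contraT => rk; have : k \in s by rewrite mem_filter rk mem_enum.
  by rewrite s0.
have [||k sk|k [f [_ f0]]] := @lead_sum _ s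
    (fun k => r 0 k *: iter k (ad a) b) (fun k => r 0 k * e k)
    (fun k => ray g k%:Z + h) _ _ s0.
- by rewrite filter_uniq // enum_uniq.
- move=> i j /addIr [/eqP E1 /eqP E2]; apply/val_inj/eqP => /=.
  rewrite -subr_eq0 -mulrBr mulf_eq0 subr_eq0 in E1.
  rewrite -subr_eq0 -mulrBr mulf_eq0 subr_eq0 in E2.
  apply: contraT => ij; move: E1 E2; rewrite !eqz_nat (negPf ij) !orbF => /eqP E1 /eqP E2.
  by case/eqP: g0; exact: injective_projections.
- move: sk; rewrite mem_filter => /andP[rk _]; have [ek be] := eE k.
  by split; [rewrite mulf_neq0 | exact: leadZ].
have -> : \sum_(k <- s) r 0 k *: iter k (ad a) b = 0.
  rewrite /s big_filter -[RHS]rE [RHS](bigID (fun k => r 0 k != 0)) /=.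
  rewrite [X in _ = _ + X]big1 ?addr0 => [|i].
    by rewrite big_enum_cond.
  by rewrite negbK => /eqP ->; rewrite scale0r.
by move=> /(lead_neq0 f0); rewrite eqxx.
Qed.

(** A subring [S] whose values are the multiples of the value [w] of one of its
    elements [e] behaves like a subring of Laurent series in [e]. *)
Section DiscreteSubring.
Context (S : Q -> Prop) (e : Q) (ce : K) (w : int * int).
Context (SD : forall s t, S s -> S t -> S (s - t))
  (SZ : forall k s, S s -> S (k *: s)) (SM : forall s t, S s -> S t -> S (s * t))
  (S1 : S 1) (Se : S e) (pw : pos w) (ce0 : ce != 0) (le : lead e ce w)
  (Sval : forall s, S s -> s != 0 ->
     exists k d, d != 0 /\ lead s d (ray w k)).

(** The value of [s] is at least [k w]. *)
Definition lead_at (s : Q) (k : int) : Prop := exists d, lead s d (ray w k).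

Lemma lead_at_le s k m : m <= k -> lead_at s k -> lead_at s m.
Proof.
move=> mk [d sd]; have [->|mk'] := eqVneq m k; first by exists d.
exists 0; apply: lead_low sd _; rewrite -rayN -rayD pos_ray // subr_gt0.
by rewrite lt_neqAle mk'.
Qed.

Lemma lead_atM s t k m : lead_at s k -> lead_at t m -> lead_at (s * t) (k + m).
Proof.
by move=> [c sc] [d td]; exists (c * d * mtwist (ray w k) (ray w m));
  rewrite rayD; exact: leadM.
Qed.

Lemma lead_at_ad s t k m : lead_at s k -> lead_at t m -> lead_at (ad s t) (k + m).
Proof.
move=> sk tm; have [c sc] := lead_atM sk tm; have [d td] := lead_atM tm sk.
by exists (c - d); apply: leadB => //; rewrite addrC.
Qed.

Lemma lead_at_val s k m d : d != 0 -> lead s d (ray w k) -> lead_at s m -> m <= k.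
Proof.
move=> d0 sk [c sm]; have := lead_ge d0 sk sm.
by rewrite -rayN -rayD pos_ray // subr_gt0 -leNgt.
Qed.

Lemma lead_at_eq0 s (m : int) : S s -> (forall n : nat, lead_at s (n%:Z + m)) -> s = 0.
Proof.
move=> Ss H; apply/eqP; apply: contraT => /(Sval Ss) [k [d [d0 sk]]].
have := lead_at_val d0 sk (H `|k - m|.+1%N); lia.
Qed.

Lemma S_eX n : S (e ^+ n).
Proof. by elim: n => [|n IH]; rewrite ?expr0 // exprS; exact: SM. Qed.

Lemma lead_eX n : exists2 c, c != 0 & lead (e ^+ n) c (ray w n%:Z).
Proof.
elim: n => [|n [c c0 en]].
  exists 1; first exact: oner_neq0.
  by rewrite expr0 ray0 -[X in lead X]scale1r; exact: lead_const.
exists (ce * c * mtwist w (ray w n%:Z)); first by rewrite !mulf_neq0 ?mtwist_neq0.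
by rewrite exprS intS rayD ray1; exact: leadM.
Qed.

(** As the residue field is [K], a scalar multiple of a power of [e] cancels the
    leading term of the error.  Of the resulting polynomial [p] in [e], only its
    commutation with the centralizer of [e] is recorded. *)
Lemma approx_e s n : S s -> lead_at s 0 -> exists p,
  [/\ S p, forall t, ad t e = 0 -> ad t p = 0 & lead_at (s - p) n%:Z].
Proof.
move=> Ss s0; elim: n => [|n [p [Sp pe [d sp]]]].
  exists 0; rewrite subr0; split=> //; first by rewrite -(subrr 1); exact: SD.
  by move=> t _; rewrite ad0.
have [c c0 en] := lead_eX n.
have ad_eX t : ad t e = 0 -> ad t (e ^+ n) = 0.
  move=> te; elim: (n) => [|m IH]; first by rewrite expr0 /ad mulr1 mul1r subrr.
  by rewrite exprS adM te IH mul0r mulr0 addr0.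
have Sr : S (s - (p + (d / c) *: e ^+ n)).
  rewrite opprD addrA; apply: SD; last exact/SZ/S_eX.
  exact: SD.
exists (p + (d / c) *: e ^+ n); split.
- rewrite -[X in p + X]opprK -scaleNr; apply: SD => //.
  exact/SZ/S_eX.
- by move=> t te; rewrite adD adZ pe // ad_eX // scaler0 addr0.
set r := s - _ in Sr *; have [->|r0] := eqVneq r 0; first by exists 0; exact: lead0.
have rn : lead r 0 (ray w n%:Z).
  rewrite /r opprD addrA -(subrr d); apply: leadB => //.
  by rewrite -{2}(divfK c0 d); exact: leadZ.
have [k [f [f0 rk]]] := Sval Sr r0.
have nk : n%:Z <= k by apply: lead_at_val f0 rk _; exists 0.
have nk' : n%:Z != k.
  by apply: contraNneq f0 => nk'; rewrite nk' in rn; rewrite (lead_uniq rk rn).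
by apply: (@lead_at_le r k); [lia | exists f].
Qed.

(** Replacing [s] by [s - p], with [p] a polynomial in [e], does not change the
    commutator with [e], whose value is therefore arbitrarily large. *)
Lemma positive_comm_e s : S s -> lead_at s 0 -> ad s e = 0.
Proof.
move=> Ss s0; apply: (@lead_at_eq0 _ 1) => [|n]; first by apply: SD; exact: SM.
have [p [Sp pe sp]] := approx_e n Ss s0.
have -> : ad s e = ad (s - p) e.
  have : ad e p = 0 by apply: pe; rewrite /ad subrr.
  move=> /eqP; rewrite subr_eq0 => /eqP E.
  by rewrite /ad mulrBl mulrBr E opprB addrA subrK.
by apply: lead_at_ad => //; exists ce; rewrite ray1.
Qed.

Lemma shift_positive s : S s -> exists n : nat, lead_at (s * e ^+ n) 0.
Proof.
move=> Ss; have [->|s0] := eqVneq s 0; first by exists 0%N, 0; rewrite mul0r; exact: lead0.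
have [k [d [d0 sk]]] := Sval Ss s0; exists `|k|%N; have [c _ en] := lead_eX `|k|%N.
apply: (@lead_at_le _ (k + `|k|%N)); first by lia.
by apply: lead_atM; [exists d | exists c].
Qed.

Lemma e_neq0 : e != 0. Proof. exact: lead_neq0 le. Qed.

Lemma comm_e s : S s -> ad s e = 0.
Proof.
move=> Ss; have [n sn] := shift_positive Ss.
have sne := positive_comm_e (SM Ss (S_eX n)) sn.
have eU : e ^+ n \is a GRing.unit by apply/unitrX/Qdiv/e_neq0.
apply: (mulIr eU); rewrite mul0r -sne /ad mulrBl -!mulrA -exprSr -exprS.
by rewrite mulrA.
Qed.

(** Approximate [s e ^+ n], of nonnegative value, by polynomials in [e]: these
    commute with [t], so the commutator with [t] has arbitrarily large value. *)
Lemma discrete_comm s t : S s -> S t -> ad s t = 0.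
Proof.
move=> Ss St; have [->|t0] := eqVneq t 0; first by rewrite ad0.
have [n sn] := shift_positive Ss.
have eU : e ^+ n \is a GRing.unit by apply/unitrX/Qdiv/e_neq0.
have te : t * e ^+ n = e ^+ n * t.
  by apply/commrX/eqP; rewrite -subr_eq0; apply/eqP/comm_e.
suff E : ad (s * e ^+ n) t = 0.
  apply: (mulIr eU); rewrite mul0r -[RHS]E /ad mulrBl -!mulrA te.
  by rewrite !mulrA.
have Sse := SM Ss (S_eX n).
have [k [d [d0 tk]]] := Sval St t0.
apply: (@lead_at_eq0 _ k) => [|m]; first by apply: SD; exact: SM.
have [p [Sp pe sp]] := approx_e m Sse sn.
have -> : ad (s * e ^+ n) t = ad (s * e ^+ n - p) t.
  have : ad t p = 0 by apply/pe/comm_e.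
  move=> /eqP; rewrite subr_eq0 => /eqP E.
  by rewrite [RHS]/ad mulrBl mulrBr E opprB addrA subrK.
by apply: lead_at_ad => //; exists d.
Qed.
End DiscreteSubring.

(** If the leading exponent of [a] is zero, subtracting the leading coefficient
    changes it. *)
Lemma nonscalar_shift (a : Q) : (forall k, a <> k%:A) ->
  exists k c g, [/\ c != 0, g != 0 & lead (a - k%:A) c g].
Proof.
move=> aK; have nz k : a - k%:A != 0 by rewrite subr_eq0; apply/eqP.
have [c [g [c0 ag]]] := lead_ex (nz 0).
have [g0|g0] := eqVneq g 0; last by exists 0, c, g.
have [d [h [d0 ah]]] := lead_ex (nz c); exists c, d, h; split=> //.
apply: contraNneq d0 => h0; rewrite h0 in ah; rewrite g0 scale0r subr0 in ag.
by rewrite (lead_uniq ah (leadB ag (lead_const c))) subrr.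
Qed.

(** The values of [F(a)] lie on the line of the value of [a] and, since [a] and
    its inverse belong to [F(a)], they form a cyclic group. *)
Theorem adfin_comm_adfin (a b c : Q) : (forall k, a <> k%:A) ->
  adfin a b -> adfin a c -> b * c = c * b.
Proof.
move=> /nonscalar_shift [k [ca [g [ca0 g0 la]]]].
set a' := a - k%:A in la.
have adE : ad a = ad a' by apply/funext => x; rewrite ad_subC.
rewrite /adfin !adE; rewrite -/(adfin a' b) -/(adfin a' c).
have [w [n [pw n0 gE par]]] := parallel_ray g0.
pose H m := exists s d, [/\ adfin a' s, d != 0 & lead s d (ray w m)].
have aa : adfin a' a' by apply: adfin_comm; rewrite /ad subrr.
have aU : a' \is a GRing.unit by apply/Qdiv/(lead_neq0 ca0 la).
have [|||h [h0 [e [ce [Se ce0 le]]] Hh]] := @int_monoid_generator H n n0.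
- by exists a', ca; rewrite -gE.
- have [d d0 ld] := leadV ca0 la; exists a'^-1, d; rewrite rayN -gE; split=> //.
  by apply: adfin_comm; rewrite /ad mulrV // mulVr // subrr.
- move=> i j [s [d [Ss d0 ls]]] [t [f [St f0 lt]]].
  exists (s * t), (d * f * mtwist (ray w i) (ray w j)).
  by rewrite !mulf_neq0 ?mtwist_neq0 // rayD; split=> //; [exact: adfinM|exact: leadM].
move=> Sb Sc; apply/eqP; rewrite -subr_eq0; apply/eqP.
apply: (@discrete_comm (adfin a') e ce (ray w h)) => //.
- by move=> s t; exact: adfinB.
- by move=> d s; exact: adfinZ.
- by move=> s t; exact: adfinM.
- by apply: adfin_comm; rewrite /ad mulr1 mul1r subrr.
- by rewrite pos_ray.
move=> s Ss s0; have [d [l [d0 ls]]] := lead_ex s0.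
have [m lE] := par _ (adfin_parallel ca0 d0 g0 la ls Ss).
have [j jE] : exists j, m = h * j by apply: Hh; exists s, d; rewrite -lE.
by exists j, d; rewrite rayM -jE -lE.
Qed.
End QuantumTorus.
(** * Scalar extension *)

(** A maximal subspace [W] that avoids [v] is a complement of the line of [v], by
    the usual one-dimensional extension; [phi] is the coordinate along [v]. *)
Lemma exists_functional (K : fieldType) (V : lmodType K) (v : V) : v != 0 ->
  exists2 phi : V -> K,
    forall k u w, phi (k *: u + w) = k * phi u + phi w & phi v = 1.
Proof.
move=> v0.
(* no condition that 0 is in W, so that the union of the empty chain qualifies *)
pose P := [set W : set V | (forall k u w, W u -> W w -> W (k *: u + w)) /\ ~ W v]%classic.
have [F FP Ftot|W [[WL Wv] Wmax]] := @Zorn_bigcup V P.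
  split=> [k u w [A FA Au] [B FB Bw]|[A FA]]; last by have [_] := FP _ FA.
  have [AB|BA] := Ftot _ _ FA FB.
    by exists B => //; have [BL _] := FP _ FB; apply: BL => //; exact: AB.
  by exists A => //; have [AL _] := FP _ FA; apply: AL => //; exact: BA.
have W0 : W 0.
  apply: contrapT => W0; apply: (Wmax [set 0]%classic).
    split=> [u Wu|/(_ 0 erefl)//].
    by case: W0; rewrite -(subrr u) addrC -scaleN1r; exact: WL.
  by split=> [k u w -> ->|/eqP]; [rewrite scaler0 addr0 | rewrite (negPf v0)].
have WZ k u : W u -> W (k *: u) by move=> Wu; rewrite -[_ *: _]addr0; exact: WL.
have WD u w : W u -> W w -> W (u + w) by rewrite -[u in u + w]scale1r; exact: WL.
have WN u : W u -> W (- u) by rewrite -scaleN1r; exact: WZ.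
have split_v u : exists k, W (u - k *: v).
  apply: contrapT => nu; pose B := [set w + c *: u | w in W & c in [set: K]]%classic.
  apply: (Wmax B).
    split=> [w Ww|BW]; first by exists w => //; exists 0 => //; rewrite scale0r addr0.
    apply: nu; exists 0; rewrite scale0r subr0; apply: BW.
    by exists 0 => //; exists 1 => //; rewrite scale1r add0r.
  split=> [k _ _ [w Ww [c _ <-]] [w' Ww' [c' _ <-]]|[w Ww [c _ vE]]].
    exists (k *: w + w'); first exact: WL.
    by exists (k * c + c') => //; rewrite scalerDr scalerA scalerDl addrACA.
  have c0 : c != 0.
    by apply/eqP => c0; move: vE; rewrite c0 scale0r addr0 => vE; rewrite vE in Ww.
  apply: nu; exists c^-1; rewrite -vE scalerDr scalerA mulVf // scale1r.
  by rewrite opprD addrC subrK; exact/WN/WZ.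
have [phi phiW] := choice split_v.
have phi_uniq u k : W (u - k *: v) -> phi u = k.
  move=> Wk; apply/eqP; rewrite -subr_eq0; apply: contraT => d0; case: Wv.
  have : W ((phi u - k)^-1 *: ((u - k *: v) - (u - phi u *: v))).
    by apply/WZ/WD => //; exact/WN.
  rewrite opprB [_ + (_ - u)]addrC addrA subrK -scalerBl scalerA mulVf //.
  by rewrite scale1r.
exists phi => [k u w|]; apply: phi_uniq; last by rewrite scale1r subrr.
have -> : k *: u + w - (k * phi u + phi w) *: v =
    k *: (u - phi u *: v) + (w - phi w *: v).
  by rewrite scalerDl opprD addrACA scalerBr scalerA.
exact: WL.
Qed.

Section ScalarExtensionEigenvectors.
Context {K Kbar : fieldType} (iota : {rmorphism K -> Kbar}) {B : algType K}.
Implicit Types (a b : B).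

Local Notation one_tens := (tpure iota 1).

(** If [b] is not zero, a functional [phi] with [phi b = 1] yields the balanced
    map [(l, u) |-> l * phi u], which does not vanish at [(1, b)]. *)
Lemma tpure1_inj b : one_tens b = 0 -> b = 0.
Proof.
move=> b0; apply/eqP; apply: contraT => /exists_functional [phi phiL phib].
have phiD u w : phi (u + w) = phi u + phi w.
  by rewrite -[u in LHS]scale1r phiL mul1r.
have phi0 : phi 0 = 0 by apply: (addrI (phi 0)); rewrite -phiD !addr0.
have phiZ k u : phi (k *: u) = k * phi u by rewrite -[_ *: _]addr0 phiL phi0 addr0.
have bal : balanced iota (fun (l : Kbar) (u : B) => l * iota (phi u)).
  split=> [l m u|l u w|c l u]; first by rewrite mulrDl.
    by rewrite phiD rmorphD mulrDr.
  by rewrite phiZ rmorphM mulrA [l * _]mulrC.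
have := tlift_pure bal 1 b; rewrite b0 (tlift0 bal) phib rmorph1 mulr1 => /esym/eqP.
by rewrite oner_eq0.
Qed.

Lemma tpure1D a b : one_tens (a + b) = one_tens a + one_tens b.
Proof. by case: (tpure_balanced iota B) => _ + _; exact. Qed.

Lemma tpure10 : one_tens (0 : B) = 0.
Proof. by apply: (addrI (one_tens 0)); rewrite -tpure1D !addr0. Qed.

Lemma tpure1N a : one_tens (- a) = - one_tens a.
Proof. by apply/eqP; rewrite -addr_eq0 -tpure1D addNr tpure10. Qed.

Lemma tpure1Z c a : one_tens (c *: a) = iota c *: one_tens a.
Proof.
case: (tpure_balanced iota B) => _ _ <-; apply: tens_ext => M f Hf.
by rewrite (tlift_pure Hf) (tliftZ Hf) (tlift_pure (balanced_scale Hf _)).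
Qed.

Lemma tpure1_sum (I : Type) (r : seq I) (F : I -> B) :
  one_tens (\sum_(i <- r) F i) = \sum_(i <- r) one_tens (F i).
Proof. exact: (big_morph one_tens tpure1D tpure10). Qed.

Lemma tpure1_ad a b : one_tens (ad a b) = ad (one_tens a) (one_tens b).
Proof. by rewrite /ad tpure1D tpure1N !tpureM mulr1. Qed.

Lemma tpure1_iter_ad k a b :
  one_tens (iter k (ad a) b) = iter k (ad (one_tens a)) (one_tens b).
Proof. by elim: k => //= k IH; rewrite tpure1_ad IH. Qed.

Lemma tens_adZ (x y : tens iota B) l : ad x (l *: y) = l *: ad x y.
Proof. by rewrite /ad -tens_scalerAr -tens_scalerAl scalerBr. Qed.

Lemma iter_ad_eigen k (x y : tens iota B) l :
  ad x y = l *: y -> iter k (ad x) y = l ^+ k *: y.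
Proof.
move=> xy; elim: k => [|k IH]; first by rewrite expr0 scale1r.
by rewrite iterS IH tens_adZ xy scalerA exprSr.
Qed.

Lemma tens_iter_ad_sum k (x : tens iota B) (I : Type) (r : seq I) F :
  iter k (ad x) (\sum_(i <- r) F i) = \sum_(i <- r) iter k (ad x) (F i).
Proof.
apply: (big_morph (iter k (ad x))).
  elim: k => [//|k IH] y z; rewrite !iterS IH.
  by rewrite /ad mulrDr mulrDl opprD addrACA.
by elim: k => [//|k IH]; rewrite iterS IH /ad mulr0 mul0r subrr.
Qed.

(** A polynomial over [K] that vanishes at all the eigenvalues involved, applied
    to [ad a], kills [1 ⊗ b], hence [b]. *)
Lemma eigenspace_sum_adfin (alg : forall z : Kbar, algebraicOver iota z) a b :
  eigenspace_sum iota a b -> adfin a b.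
Proof.
move=> [s [sE bE]].
have [p p0 proot] : exists2 p : {poly K}, p != 0 &
    forall e, e \in s -> root (map_poly iota p) e.1.
  elim: (s) => [|e r [p p0 proot]]; first by exists 1; rewrite ?oner_neq0.
  have [f f0 fe] := alg e.1; exists (f * p); first by rewrite mulf_neq0.
  move=> d; rewrite inE rmorphM rootM => /predU1P[->|/proot ->]; first by rewrite fe.
  by rewrite orbT.
apply: (adfin_poly p0); apply: tpure1_inj; rewrite tpure1_sum.
transitivity (\sum_(e <- s) (map_poly iota p).[e.1] *: e.2).
  transitivity (\sum_(i < size p) \sum_(e <- s) (iota p`_i * e.1 ^+ i) *: e.2).
    apply: eq_bigr => i _; rewrite tpure1Z tpure1_iter_ad bE tens_iter_ad_sum.
    rewrite scaler_sumr big_seq [RHS]big_seq; apply: eq_bigr => e es.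
    by rewrite (iter_ad_eigen _ (sE _ es)) scalerA.
  rewrite exchange_big; apply: eq_bigr => e _; rewrite -scaler_suml; congr (_ *: _).
  rewrite (@horner_coef_wide _ (size p)) ?size_map_poly //.
  by apply: eq_bigr => i _; rewrite coef_map.
by rewrite big_seq big1 // => e /proot /rootP ->; rewrite scale0r.
Qed.

Lemma centralizer_eigenspace_sum a b : centralizer a b -> eigenspace_sum iota a b.
Proof.
move=> ab; exists [:: (0, one_tens b)]; split; last by rewrite big_seq1.
by move=> p; rewrite inE => /eqP -> /=; rewrite -tpure1_ad ab tpure10 scale0r.
Qed.
End ScalarExtensionEigenvectors.

(** * Algebras in which every noncentral element is generic *)

Section GenericAlgebra.
Context {K Kbar : fieldType} (iota : {rmorphism K -> Kbar})
  (alg : forall z : Kbar, algebraicOver iota z) {B : algType K}.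
Context (Bnc : noncommutative B)
  (adfinC : forall a b c : B, ~ (@Defs.center B) a -> adfin a b -> adfin a c -> b * c = c * b).

Lemma adfin_centralizer (a b : B) : ~ (@Defs.center B) a -> adfin a b -> centralizer a b.
Proof.
move=> aZ ab; rewrite /centralizer /= /ad (adfinC aZ ab (c := a)) ?subrr //.
by apply: adfin_comm; rewrite /ad subrr.
Qed.

Lemma noncentral_generic (a : B) : ~ (@Defs.center B) a -> generic iota a.
Proof.
move=> aZ.
have DC : eigenspace_sum iota a = centralizer a.
  apply/seteqP; split=> b; last exact: centralizer_eigenspace_sum.
  by move=> /(eigenspace_sum_adfin alg) /(adfin_centralizer aZ).
split=> //; rewrite DC; apply/seteqP; split=> b; last by move=> ab; exists 0%N.
move=> [i _ ib]; apply: adfin_centralizer => //.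
apply: (@adfin_poly _ _ _ _ 'X^(i.+1)); first by rewrite -size_poly_eq0 size_polyXn.
rewrite size_polyXn big_ord_recr /= big1 ?add0r => [|j _].
  by rewrite coefXn eqxx scale1r; exact: ib.
by rewrite coefXn ltn_eqF // scale0r.
Qed.

Lemma centralizer_id (a : B) : centralizer a a.
Proof. by rewrite /centralizer /= /ad subrr. Qed.

Lemma centralizer_full (a : B) : centralizer a = setT -> (@Defs.center B) a.
Proof. by move=> aT b; have : centralizer a b by rewrite aT. Qed.

(** Each of the first four kinds would provide a noncentral element that is not
    generic: [a] itself, or the element [a'] spanning the exceptional line. *)
Lemma unique_centralizer_kind (a : B) : ~ (@Defs.center B) a ->
  exists! i : 'I_5, centralizer_kind iota a i.
Proof.
move=> aZ; have Sa : (centralizer a `\` @Defs.center B)%classic a.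
  by split; [exact: centralizer_id|].
have no_punctured T : (forall b, T b -> ~ generic iota b) ->
    ~ generic_except iota T (centralizer a `\` @Defs.center B)%classic.
  move=> nT [b [Tb line _]]; apply: (nT b Tb); apply: noncentral_generic.
  suff /line [[_ bZ] _] : punctured_line b b by exact: bZ.
  exists 1, 0; split; [exact: oner_neq0| |by rewrite scale1r addr0].
  by move=> c; rewrite /ad mul0r mulr0 subrr.
exists (@Ordinal 5 4 isT); split.
  by rewrite /centralizer_kind /= => b [_ bZ]; exact: noncentral_generic.
case=> -[|[|[|[|[|i]]]]] i5 //.
- rewrite /centralizer_kind /= => /(_ a Sa) [_ NT _].
  by have [_ ND DC] := noncentral_generic aZ; case: aZ; apply: centralizer_full; rewrite -DC -ND.
- rewrite /centralizer_kind /= => /(_ a Sa) [_ CN _ _].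
  by case: CN; have [_ -> ->] := noncentral_generic aZ.
- case/no_punctured => b [bZ _ DT] [_ _ DC].
  by case: bZ; apply: centralizer_full; rewrite -DC.
- case/no_punctured => b [_ _ CD _ _] [_ _ DC].
  exact: CD.
- by move=> _; apply: val_inj.
Qed.

Lemma generic_conditions : [/\ dixmier_partition iota B,
  homogeneous_centralizers iota B & commutative_centralizers B].
Proof.
have dix : dixmier_partition iota B.
  apply/seteqP; split=> a; first by move=> aZ; right; exact: noncentral_generic.
  by move=> [[[[|]|]|]|] [].
split=> //; first by split=> //; exact: unique_centralizer_kind.
split=> // a aZ b c ab ac; by apply: (adfinC aZ); exact: adfin_comm.
Qed.
End GenericAlgebra.
Section Transfer.
Context {K : fieldType} {B Q : algType K} (f : {lrmorphism B -> Q}).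

Lemma lrmorph_ad (a b : B) : f (ad a b) = ad (f a) (f b).
Proof. by rewrite /ad rmorphB !rmorphM. Qed.

Lemma lrmorph_adfin (a b : B) : adfin a b -> adfin (f a) (f b).
Proof.
move=> [I [u ub]]; exists I, (f \o u) => k.
have -> : iter k (ad (f a)) (f b) = f (iter k (ad a) b).
  by elim: k => //= k ->; rewrite lrmorph_ad.
have [c ->] := ub k; exists c; rewrite linear_sum.
by apply: eq_bigr => i _; rewrite linearZ.
Qed.

(** A noncentral element of [B] is sent to a nonscalar one, since scalars are
    central. *)
Lemma sub_adfin_comm : injective f ->
  (forall a b c : Q, (forall k, a <> k%:A) -> adfin a b -> adfin a c -> b * c = c * b) ->
  forall a b c : B, ~ (@Defs.center B) a -> adfin a b -> adfin a c -> b * c = c * b.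
Proof.
move=> finj H a b c aZ ab ac; apply: (finj); rewrite !rmorphM.
apply: (H (f a)); try exact: lrmorph_adfin.
move=> k; rewrite -(rmorph_alg f) => /finj aE; apply: aZ => e.
by rewrite aE /ad -scalerAl -scalerAr mul1r mulr1 subrr.
Qed.
End Transfer.

(** * The quantum plane and the quantum Weyl algebra *)

Section PresentedInduction.
Context {K : fieldType} {A : algType K} (S : {pred A}) (Salg : GRing.subsemialg_closed S).

Definition subalgebra : Type := {a : A | a \in S}.
HB.instance Definition _ := SubChoice.on subalgebra.
HB.instance Definition _ := GRing.SubChoice_isSubAlgebra.Build K A S subalgebra Salg.

Definition inclusion (u : subalgebra) : A := \val u.
HB.instance Definition _ := GRing.RMorphism.copy inclusion (\val : subalgebra -> A).
HB.instance Definition _ := GRing.Linear.copy inclusion (\val : subalgebra -> A).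

(** A presented algebra is generated by its generators: the universal property
    maps [A] to the subalgebra [S], and by uniqueness the composite with the
    inclusion is the identity. *)
Lemma presented_ind (rel : forall C : algType K, C -> C -> Prop) (x y : A) :
  (forall (C : algType K) (g : {lrmorphism C -> A}) u v,
     injective g -> rel A (g u) (g v) -> rel C u v) ->
  presented_by rel x y -> x \in S -> y \in S -> forall a, a \in S.
Proof.
move=> relS [rxy univ] xS yS a.
have inclI : injective inclusion by exact: val_inj.
have [|phi [phix phiy] _] := univ subalgebra (Sub x xS) (Sub y yS).
  by apply: (relS subalgebra inclusion) => //; rewrite /inclusion !SubK.
have [psi0 _ psiu] := univ A x y rxy.
have E1 : inclusion (phi a) = psi0 a.
  by apply: (psiu (inclusion \o phi)); rewrite /= ?phix ?phiy /inclusion SubK.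
have -> : a = inclusion (phi a) by rewrite E1 -(psiu idfun).
exact: valP.
Qed.
End PresentedInduction.
Lemma in_asbool (T : Type) (P : T -> Prop) (a : T) :
  reflect (P a) (a \in [pred x | `[< P x >]]).
Proof. exact: asboolP. Qed.

Section TorusFractions.
Context {K : fieldType} {A : algType K} {Q : unitAlgType K}
  (j : {lrmorphism A -> Q}) (HQ : division_ring_of_fractions j)
  (q : K) (q_neq0 : q != 0) (q_nroot : forall n, (0 < n)%N -> q ^+ n != 1)
  (X Y : Q) (X_neq0 : X != 0) (Y_neq0 : Y != 0) (XY : X * Y = q *: (Y * X)).

Lemma tspan_subalg :
  GRing.subsemialg_closed [pred a : A | `[< tspan X Y predT (j a) >]].
Proof.
have [Qdiv _ _] := HQ; split.
- by apply/in_asbool; rewrite rmorph1; exact: tspan1.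
- split; first by apply/in_asbool; rewrite rmorph0; exact: tspan0.
  move=> a b /in_asbool aT /in_asbool bT; apply/in_asbool.
  by rewrite rmorphD; exact: tspanD.
- move=> k a /in_asbool aT; apply/in_asbool.
  by rewrite linearZ; exact: tspanZ.
- move=> a b /in_asbool aT /in_asbool bT; apply/in_asbool.
  rewrite rmorphM; exact: (tspanMT Qdiv q_neq0 X_neq0 Y_neq0 XY).
Qed.

Lemma fractions_adfin_comm : (forall a, tspan X Y predT (j a)) ->
  forall a b c : Q, (forall k, a <> k%:A) ->
    adfin a b -> adfin a c -> b * c = c * b.
Proof.
move=> AT; have [Qdiv jinj jfrac] := HQ.
apply: (adfin_comm_adfin Qdiv q_neq0 q_nroot X_neq0 Y_neq0 XY) => z.
have [a [b [b0 ->]]] := jfrac z; exists (j a), (j b); split=> //.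
by rewrite -(rmorph0 j) (inj_eq jinj).
Qed.
End TorusFractions.

Lemma quantum_plane_adfin_comm (K : fieldType) (lambda : K) (A : algType K)
    (x y : A) (Q : unitAlgType K) (j : {lrmorphism A -> Q}) :
  lambda != 0 -> (forall n, (0 < n)%N -> lambda ^+ n != 1) ->
  quantum_plane lambda x y -> division_ring_of_fractions j ->
  noncommutative A /\ forall a b c : Q, (forall k, a <> k%:A) ->
    adfin a b -> adfin a c -> b * c = c * b.
Proof.
move=> l0 ln HA HQ; have [Qdiv jinj jfrac] := HQ; have [rxy univ] := HA.
have xy : x * y = lambda *: (y * x) := rxy.
have hom (u v : K^o) : u * v = 0 -> v * u = 0 ->
    exists phi : {lrmorphism A -> K^o}, phi x = u /\ phi y = v.
  move=> uv vu; have [|phi phiE _] := univ K^o u v; last by exists phi.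
  by rewrite uv vu scaler0.
(* neither generator vanishes, as x |-> 1, y |-> 0 and x |-> 0, y |-> 1 define
   algebra homomorphisms to K *)
have x0 : x != 0.
  have [||phi [px _]] := hom 1 0; rewrite ?mulr0 ?mul0r //.
  by apply: contra_eqN px => /eqP ->; rewrite rmorph0 eq_sym oner_eq0.
have y0 : y != 0.
  have [||phi [_ py]] := hom 0 1; rewrite ?mulr0 ?mul0r //.
  by apply: contra_eqN py => /eqP ->; rewrite rmorph0 eq_sym oner_eq0.
have jx0 : j x != 0 by rewrite -(rmorph0 j) (inj_eq jinj).
have jy0 : j y != 0 by rewrite -(rmorph0 j) (inj_eq jinj).
have jxy : j x * j y = lambda *: (j y * j x).
  by rewrite -rmorphM /= xy linearZ rmorphM.
split.
  exists x, y => yx; have : (lambda - 1) *: (y * x) = 0.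
    by rewrite scalerBl -xy scale1r yx subrr.
  move/eqP; rewrite scaler_eq0 subr_eq0 -[lambda]expr1 (negPf (ln 1%N isT)) /=.
  move=> /eqP /(congr1 j); rewrite rmorphM rmorph0 /= => E.
  have := unitrMl (j y) (Qdiv _ jx0).
  by rewrite E (Qdiv _ jy0) unitr0.
apply: (fractions_adfin_comm HQ l0 ln jx0 jy0 jxy) => a.
have /= := presented_ind (tspan_subalg HQ l0 jx0 jy0 jxy) _ HA _ _ a.
move=> aT; apply/in_asbool/aT.
- move=> C g u v ginj; rewrite -!rmorphM /= -linearZ; exact: ginj.
- exact/in_asbool/tspanX.
- exact/in_asbool/tspanY.
Qed.

(** It suffices to have a noncommutative model.  In 2 by 2 matrices, take
    [x = diag(1, mu)] and [d = (mu - 1)^-1 x^-1 (E12 - 1)], so that [dx - xd] is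
    the nilpotent matrix unit [E12]. *)
Lemma quantum_weyl_noncomm (K : fieldType) (mu : K) (A : algType K) (x d : A) :
  mu != 0 -> mu != 1 -> quantum_weyl mu x d -> d * x != x * d.
Proof.
move=> m0 m1 [_ univ]; have m1' : mu - 1 != 0 by rewrite subr_eq0.
pose u : 'M[K]_2 := \matrix_(i, k) (if i == k then (if i == 0 then 1 else mu) else 0).
pose v : 'M[K]_2 := \matrix_(i, k)
  ((mu - 1)^-1 * (if i == k then (if i == 0 then -1 else - mu^-1)
                  else (if i == 0 then 1 else 0))).
have [|phi [px pd] _] := univ 'M[K]_2 u v.
  apply/matrixP => i k; rewrite !mxE !big_ord_recl !big_ord0 !mxE.
  case: i => [[|[|i]] i2] //=; case: k => [[|[|k]] k2] //=;
  rewrite ?mulr1n ?mulr0n; by field; rewrite ?m0 ?m1'.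
apply/eqP => /(congr1 phi); rewrite !rmorphM /= px pd => /matrixP /(_ 0 1).
rewrite !mxE !big_ord_recl !big_ord0 !mxE /= !(mulr0, mul0r, addr0, add0r, mulr1, mul1r).
rewrite -[RHS]mulr1 => /(mulfI (invr_neq0 m1')) /eqP.
by rewrite (negPf m1).
Qed.

(** Here [z = dx - xd] satisfies [z x = mu x z], and [d] is recovered from
    [z = 1 + (mu - 1) x d]. *)
Lemma quantum_weyl_adfin_comm (K : fieldType) (mu : K) (A : algType K)
    (x d : A) (Q : unitAlgType K) (j : {lrmorphism A -> Q}) :
  mu != 0 -> (forall n, (0 < n)%N -> mu ^+ n != 1) ->
  quantum_weyl mu x d -> division_ring_of_fractions j ->
  noncommutative A /\ forall a b c : Q, (forall k, a <> k%:A) ->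
    adfin a b -> adfin a c -> b * c = c * b.
Proof.
move=> m0 mn HA HQ; have [Qdiv jinj jfrac] := HQ; have [rdx univ] := HA.
have dx : d * x - mu *: (x * d) = 1 := rdx.
have m1 : mu != 1 by have := mn 1%N isT; rewrite expr1.
have nc := quantum_weyl_noncomm m0 m1 HA.
split; first by exists d, x; exact/eqP.
pose z := d * x - x * d.
have z0 : z != 0 by rewrite subr_eq0.
have x0 : x != 0.
  by apply: contraNneq nc => ->; rewrite mulr0 mul0r.
have dxE : d * x = 1 + mu *: (x * d) by rewrite -dx subrK.
have zE : z = 1 + (mu - 1) *: (x * d).
  by rewrite /z dxE scalerBl scale1r addrA.
have zx : z * x = mu *: (x * z).
  have -> : z * x = x + (mu - 1) *: (x * (d * x)).
    by rewrite zE mulrDl mul1r -scalerAl mulrA.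
  rewrite zE dxE !mulrDr !mulr1 -!scalerAr !scalerDr !scalerA.
  by rewrite addrA -[X in X + _ *: x + _]scale1r -scalerDl [1 + _]addrC subrK [mu * (mu - 1)]mulrC.
have jx0 : j x != 0 by rewrite -(rmorph0 j) (inj_eq jinj).
have jz0 : j z != 0 by rewrite -(rmorph0 j) (inj_eq jinj).
have jxz : j x * j z = mu^-1 *: (j z * j x).
  by rewrite -!rmorphM /= zx linearZ scalerA mulVf // scale1r.
have mV0 : mu^-1 != 0 by rewrite invr_eq0.
have mVn n : (0 < n)%N -> mu^-1 ^+ n != 1.
  by move=> /mn; rewrite exprVn invr_eq1.
apply: (fractions_adfin_comm HQ mV0 mVn jx0 jz0 jxz) => a.
have /= := presented_ind (tspan_subalg HQ mV0 jx0 jz0 jxz) _ HA _ _ a.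
move=> aT; apply/in_asbool/aT.
- move=> C g u v ginj; rewrite -!rmorphM /= -linearZ -rmorphB -(rmorph1 g).
  exact: ginj.
- exact/in_asbool/tspanX.
apply/in_asbool.
have -> : j d = (mu - 1)^-1 *: ((j x)^-1 * (j z - 1)).
  have m1' : mu - 1 != 0 by rewrite subr_eq0.
  rewrite zE rmorphD rmorph1 /= [1 + _]addrC addrK.
  rewrite linearZ rmorphM /= -scalerAr scalerA mulVf // scale1r mulrA.
  by rewrite mulVr ?mul1r //; exact: Qdiv.
apply: tspanZ; apply: (tspanMT Qdiv mV0 jx0 jz0 jxz); first exact: tspanXV.
by apply: tspanD; [exact: tspanY | apply: tspanN; exact: tspan1].
Qed.
Theorem corollary5p4 (R : realType)
  (K : fieldType) (charK : [pchar K] =i pred0)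
  (Kbar : closedFieldType) (iota : {rmorphism K -> Kbar})
  (Kbar_closure : is_algebraic_closure iota)
  (lambda mu : K) (lambda_neq0 : lambda != 0) (mu_neq0 : mu != 0)
  (lambda_nroot : forall n : nat, (0 < n)%N -> lambda ^+ n != 1)
  (mu_nroot : forall n : nat, (0 < n)%N -> mu ^+ n != 1)
  (Lambda : algType K) (x y : Lambda) (HLambda : quantum_plane lambda x y)
  (A1 : algType K) (x1 d1 : A1) (HA1 : quantum_weyl mu x1 d1)
  (QLambda : unitAlgType K) (jLambda : {lrmorphism Lambda -> QLambda})
  (HQLambda : division_ring_of_fractions jLambda)
  (QA1 : unitAlgType K) (jA1 : {lrmorphism A1 -> QA1})
  (HQA1 : division_ring_of_fractions jA1) :
  (commutative_centralizers QLambda /\ commutative_centralizers QA1)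
  /\
  [/\ [/\ dixmier_partition iota Lambda,
          homogeneous_centralizers iota Lambda
        & commutative_centralizers Lambda],
      [/\ dixmier_partition iota A1,
          homogeneous_centralizers iota A1
        & commutative_centralizers A1]
    & forall (B : algType K) (f : {lrmorphism B -> QLambda}),
        injective f -> noncommutative B -> (GKdim B R < 3%:R%:E)%E ->
        [/\ dixmier_partition iota B,
            homogeneous_centralizers iota B
          & commutative_centralizers B]].
Proof.
have [ncL commL] := quantum_plane_adfin_comm lambda_neq0 lambda_nroot HLambda HQLambda.
have [ncA commA] := quantum_weyl_adfin_comm mu_neq0 mu_nroot HA1 HQA1.
have [_ jLI _] := HQLambda; have [_ jAI _] := HQA1.
have sub (Q B : algType K) (f : {lrmorphism B -> Q}) :
    (forall a b c : Q, (forall k, a <> k%:A) ->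
       adfin a b -> adfin a c -> b * c = c * b) ->
    injective f -> noncommutative B ->
    [/\ dixmier_partition iota B, homogeneous_centralizers iota B
      & commutative_centralizers B].
  by move=> QC finj Bnc; apply: (generic_conditions Kbar_closure Bnc);
    exact: (sub_adfin_comm finj QC).
have ncQ (A Q : algType K) (f : {lrmorphism A -> Q}) :
    injective f -> noncommutative A -> noncommutative Q.
  by move=> finj [a [b ab]]; exists (f a), (f b); rewrite -!rmorphM => /finj.
split.
  have [||_ _ CL] := sub _ _ (idfun : {lrmorphism QLambda -> QLambda}) commL.
  - by [].
  - exact: ncQ jLI ncL.
  have [||_ _ CA] := sub _ _ (idfun : {lrmorphism QA1 -> QA1}) commA.
  - by [].
  - exact: ncQ jAI ncA.
  by [].
split; [exact: sub commL jLI ncL | exact: sub commA jAI ncA |].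
by move=> B f finj ncB _; exact: sub commL finj ncB.
Qed.
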